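(* Let $m\in\mathbb{Z}$ with $|m|\ge 1$, $R>0$, and $N_0>0$. Then there exists a solution pair $(A,\lambda)$, with $\lambda\in\mathbb{R}$ and $A(r)>0$ for all $r\in(0,R)$, of the boundary value problem $$\frac{d^2A}{dr^2}+\frac1r\frac{dA}{dr}-\frac{m^2}{r^2}A-\lambda A+\frac{A^3}{(1+A^2)^2}=0,\quad r\in(0,R),\qquad A(0)=0=A(R),$$ subject to the prescribed photon number $$N(A)=2\pi\int_0^R rA^2\,dr=N_0.$$
   Context: A solution pair $(A,\lambda)$ consists of a real number $\lambda$ (the nonlinear frequency shift, not prescribed here) and a real-valued function $A$, continuous on $[0,R]$ and twice differentiable on $(0,R)$, satisfying the differential equation on $(0,R)$ and the boundary conditions. *)

(* Defs.v *)
From Stdlib Require Import Reals ZArith.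
From Coquelicot Require Import Coquelicot.
Open Scope R_scope.

(* [ex_derive_n A 2 r] alone only says that the total function [Derive A] is
   differentiable at [r]; together with [ex_derive A] on the whole interval it
   says that [A] is twice differentiable there.  Values of [A] outside
   [0, rad] are irrelevant throughout. *)
Definition twice_differentiable_on_open (A : R -> R) (a b : R) : Prop :=
  forall r : R, a < r < b -> ex_derive A r /\ ex_derive_n A 2 r.

Definition vortex_equation_at (m : Z) (lambda : R) (A : R -> R) (r : R) : Prop :=
  Derive_n A 2 r + 1 / r * Derive A r - IZR m ^ 2 / r ^ 2 * A r
    - lambda * A r + A r ^ 3 / (1 + A r ^ 2) ^ 2 = 0.

Definition solution_pair (m : Z) (rad : R) (A : R -> R) (lambda : R) : Prop :=
  continuous_on (fun r : R => 0 <= r <= rad) A /\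
  twice_differentiable_on_open A 0 rad /\
  (forall r : R, 0 < r < rad -> vortex_equation_at m lambda A r) /\
  A 0 = 0 /\ A rad = 0.

Definition photon_number (rad : R) (A : R -> R) : R :=
  2 * PI * RInt (fun r : R => r * A r ^ 2) 0 rad.

(* Main.v *)
Require Import Defs.
From Stdlib Require Import Reals ZArith Lra Lia Bool ClassicalEpsilon.
From Coquelicot Require Import Coquelicot.
Open Scope R_scope.

(** The solution is found by shooting from the origin with two parameters.  Put
    [M = |m|], [p = 2 M + 1] and [A r = r ^ M * B r].  The equation becomes
    [(r^p B')' = r^p (lambda - V (r^M B)) B] with [V x = x^2 / (1 + x^2)^2], and it
    has a solution [B] for every amplitude [B 0 = a] and every [lambda], namely
    the fixed point of a Volterra operator; [B] is Lipschitz in [(a, lambda)],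
    uniformly on [0, rad] ([regular_profile_exists], [vortex_profiles_lipschitz]).
    Two conditions remain to be met by the two parameters: [B] must be positive
    on [0, rad) and vanish at [rad], and the photon number must be [N0].

    The point is that [0 <= V <= 1/4] whatever the amplitude.  Hence the range of
    [lambda] can be fixed first, as [-k, 1/4]: for [lambda = 1/4] every profile is
    positive on [0, rad], and for [lambda = -k] every profile reaches [0] there
    ([vortex_profile_positive], [vortex_profile_vanishes]).  On that range the
    photon number is below [N0] for a small amplitude [a0] and at least [N0] for a
    large one [a1] ([vortex_profiles_small], [vortex_profiles_large]).  So in the
    rectangle [a0, a1] x [-k, 1/4] the set where the photon number is below [N0]
    contains the left side and misses the right side, and the set where the
    profile reaches [0] contains the bottom and misses the top.  The two frontiers
    must meet; this is a planar form of the Poincare-Miranda theorem, proved with a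
    Sperner-type parity argument ([frontiers_cross]).

    At a common frontier point the photon number equals [N0], and the profile is
    nonnegative and touches [0].  A nonnegative profile that touches [0] at an
    interior point has a double zero there, hence vanishes identically
    ([regular_profile_no_interior_zero]); it does not, since [B 0 = a > 0].  So
    the only zero is at [rad]. *)

(** * Two frontiers in a rectangle *)

Fixpoint xor_sum (f : nat -> bool) (n : nat) : bool :=
  match n with O => false | S k => xorb (xor_sum f k) (f k) end.

Definition same4 (w x y z : bool) : Prop := w = x /\ w = y /\ w = z.

(** Label a grid point A if [p] holds, B if only [q] holds, and C otherwise.  The
    function tells whether the two ends of an edge are labelled A and B. *)
Definition ab_edge (p1 q1 p2 q2 : bool) : bool :=
  xorb (andb p1 (andb (negb p2) q2)) (andb (andb (negb p1) q1) p2).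

Lemma xor_sum_false (f : nat -> bool) (n : nat) :
  (forall i, (i < n)%nat -> f i = false) -> xor_sum f n = false.
Proof.
  induction n as [|n IH]; intros H; simpl; [reflexivity|].
  rewrite IH, H; [reflexivity|lia|intros; apply H; lia].
Qed.

Lemma xor_sum_changes (p : nat -> bool) (n : nat) :
  xor_sum (fun i => xorb (p i) (p (S i))) n = xorb (p O) (p n).
Proof.
  induction n as [|n IH]; simpl.
  - destruct (p O); reflexivity.
  - rewrite IH. destruct (p O), (p n), (p (S n)); reflexivity.
Qed.

Lemma xor_sum_ext (f g : nat -> bool) (n : nat) :
  (forall i, (i < n)%nat -> f i = g i) -> xor_sum f n = xor_sum g n.
Proof.
  induction n as [|n IH]; intros H; simpl; [reflexivity|].
  rewrite IH, H; [reflexivity|lia|intros; apply H; lia].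
Qed.

(** A closed walk through labels A, B, C that misses one of them crosses between
    A and B an even number of times.  A square on which [p] or [q] is constant
    misses a label. *)
Lemma ab_edge_square (p1 p2 p3 p4 q1 q2 q3 q4 : bool) :
  same4 p1 p2 p3 p4 \/ same4 q1 q2 q3 q4 ->
  ab_edge p3 q3 p4 q4 =
  xorb (ab_edge p1 q1 p2 q2) (xorb (ab_edge p1 q1 p3 q3) (ab_edge p2 q2 p4 q4)).
Proof.
  unfold same4.
  destruct p1, p2, p3, p4, q1, q2, q3, q4; simpl; intuition congruence.
Qed.

Lemma xor_sum_next_row (n : nat) (h h' w : nat -> bool) :
  (forall i, (i < n)%nat -> h' i = xorb (h i) (xorb (w i) (w (S i)))) ->
  xor_sum h' n = xorb (xor_sum h n) (xorb (w O) (w n)).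
Proof.
  intros H. rewrite (xor_sum_ext _ _ _ H), <- xor_sum_changes. clear H.
  induction n as [|n IH]; simpl; [reflexivity|]. rewrite IH.
  destruct (xor_sum h n), (h n), (w n), (w (S n)),
    (xor_sum (fun i => xorb (w i) (w (S i))) n); reflexivity.
Qed.

(** Parity of the A-B edges in a row: it is odd in the bottom row, which goes
    from A to B without meeting C.  It does not change from one row to the next,
    since the left side is all A and the right side has no A.  But the top row
    has no B. *)
Lemma grid_crossing (n : nat) (p q : nat -> nat -> bool)
  (hleft : forall j, (j <= n)%nat -> p O j = true)
  (hright : forall j, (j <= n)%nat -> p n j = false)
  (hbottom : forall i, (i <= n)%nat -> q i O = true)
  (htop : forall i, (i <= n)%nat -> q i n = false) :
  ~ (forall i j, (i < n)%nat -> (j < n)%nat ->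
       same4 (p i j) (p (S i) j) (p i (S j)) (p (S i) (S j)) \/
       same4 (q i j) (q (S i) j) (q i (S j)) (q (S i) (S j))).
Proof.
  intros H.
  set (h := fun j i => ab_edge (p i j) (q i j) (p (S i) j) (q (S i) j)).
  assert (Hrow : forall j, (j <= n)%nat -> xor_sum (h j) n = true).
  { induction j as [|j IH]; intros Hj.
    - rewrite (xor_sum_ext _ (fun i => xorb (p i O) (p (S i) O))).
      + rewrite (xor_sum_changes (fun i => p i O)), hleft, hright by lia. reflexivity.
      + intros i Hi. unfold h, ab_edge. rewrite !hbottom by lia.
        destruct (p i O), (p (S i) O); reflexivity.
    - rewrite (xor_sum_next_row n (h j) (h (S j))
        (fun i => ab_edge (p i j) (q i j) (p i (S j)) (q i (S j)))).
      + rewrite IH by lia. unfold ab_edge.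
        rewrite !hleft, !hright by lia. simpl. rewrite !andb_false_r; reflexivity.
      + intros i Hi. unfold h. apply ab_edge_square, H; lia. }
  assert (Htop : xor_sum (h n) n = false).
  { apply xor_sum_false. intros i Hi. unfold h, ab_edge.
    rewrite !htop by lia. destruct (p i n), (p (S i) n); reflexivity. }
  rewrite Hrow in Htop by lia. discriminate.
Qed.

(** A point of [dom] at which [settled] fails for every [e > 0] is a frontier
    point of [P] relative to [dom]. *)
Definition settled (dom P : R -> R -> Prop) (x y e : R) : Prop :=
  let near x' y' := dom x' y' /\ Rabs (x' - x) < e /\ Rabs (y' - y) < e in
  (forall x' y', near x' y' -> P x' y') \/ (forall x' y', near x' y' -> ~ P x' y').

Definition rectangle (a b c d x y : R) : Prop := a <= x <= b /\ c <= y <= d.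

Lemma grid_point_bounds (a b : R) (n i : nat) :
  a <= b -> (0 < n)%nat -> (i <= n)%nat -> a <= a + INR i * ((b - a) / INR n) <= b.
Proof.
  intros Hab Hn Hi.
  assert (Hn' : 0 < INR n) by (apply lt_0_INR; lia).
  assert (Hi' : 0 <= INR i <= INR n) by (split; [apply pos_INR | apply le_INR; lia]).
  assert (E : INR i * ((b - a) / INR n) = (b - a) * (INR i / INR n)) by (field; lra).
  assert (H1 : INR i / INR n * INR n = INR i) by (field; lra).
  assert (0 <= INR i / INR n) by (apply Rdiv_le_0_compat; lra).
  assert (INR i / INR n <= 1) by nra.
  rewrite E. nra.
Qed.

(** If no point were on both frontiers, each point would have a neighbourhood on
    which [P] or [Q] is constant.  By compactness one size of neighbourhood
    serves for all points, and a grid finer than that size contradicts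
    [grid_crossing]. *)
Lemma frontiers_cross (a b c d : R) (P Q : R -> R -> Prop)
  (hab : a <= b) (hcd : c <= d)
  (hleft : forall y, c <= y <= d -> P a y)
  (hright : forall y, c <= y <= d -> ~ P b y)
  (hbottom : forall x, a <= x <= b -> Q x c)
  (htop : forall x, a <= x <= b -> ~ Q x d) :
  exists x y, rectangle a b c d x y /\
    forall e, 0 < e ->
      ~ settled (rectangle a b c d) P x y e /\ ~ settled (rectangle a b c d) Q x y e.
Proof.
  apply NNPP. intros Hno.
  set (dom := rectangle a b c d) in *.
  assert (Hd : forall x y, exists e : posreal, dom x y ->
      settled dom P x y (2 * e) \/ settled dom Q x y (2 * e)).
  { intros x y. apply NNPP. intros He. apply Hno. exists x, y.
    assert (Hxy : dom x y).
    { apply NNPP. intros Hxy. apply He. exists (mkposreal 1 Rlt_0_1). tauto. }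
    split; [exact Hxy|]. intros e Hpos. apply NNPP. intros Hset. apply He.
    exists (mkposreal (e / 2) ltac:(lra)). intros _. simpl.
    replace (2 * (e / 2)) with e by field.
    destruct (classic (settled dom P x y e)); [now left|].
    destruct (classic (settled dom Q x y e)); [now right|]. tauto. }
  (* A square with a corner within [delta] of (u, v) and sides below [delta] lies
     within [2 * delta] of (u, v), which is why the radius is doubled. *)
  set (delta := fun x y => proj1_sig (constructive_indefinite_description _ (Hd x y))).
  assert (Hdelta : forall x y, dom x y ->
      settled dom P x y (2 * delta x y) \/ settled dom Q x y (2 * delta x y)).
  { intros x y. unfold delta.
    exact (proj2_sig (constructive_indefinite_description _ (Hd x y))). }
  clearbody delta. clear Hno Hd.
  destruct (compactness_value_2d a b c d delta) as [m Hm].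
  destruct (nfloor_ex ((b - a) / m + (d - c) / m)) as [k [_ Hk]].
  { pose proof (cond_pos m).
    assert (0 <= (b - a) / m) by (apply Rdiv_le_0_compat; lra).
    assert (0 <= (d - c) / m) by (apply Rdiv_le_0_compat; lra). lra. }
  set (n := S k).
  assert (Hn : 0 < INR n) by (apply lt_0_INR; unfold n; lia).
  replace (INR k + 1) with (INR n) in Hk by (unfold n; apply S_INR).
  set (hx := (b - a) / INR n). set (hy := (d - c) / INR n).
  assert (Hstep : 0 <= hx < m /\ 0 <= hy < m).
  { pose proof (cond_pos m) as Hm0.
    assert (E1 : (b - a) / m * m = b - a) by (field; lra).
    assert (E2 : (d - c) / m * m = d - c) by (field; lra).
    assert (0 <= (b - a) / m) by (apply Rdiv_le_0_compat; lra).
    assert (0 <= (d - c) / m) by (apply Rdiv_le_0_compat; lra).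
    unfold hx, hy. repeat split; try (apply Rdiv_le_0_compat; lra);
    apply Rlt_div_l; nra. }
  set (xi := fun i => a + INR i * hx). set (yj := fun j => c + INR j * hy).
  set (bool_of := fun (A : Prop) => if excluded_middle_informative A then true else false).
  assert (bool_true : forall A : Prop, A -> bool_of A = true).
  { intros A HA. unfold bool_of. destruct excluded_middle_informative; tauto. }
  assert (bool_false : forall A : Prop, ~ A -> bool_of A = false).
  { intros A HA. unfold bool_of. destruct excluded_middle_informative; tauto. }
  assert (Hxi : forall i, (i <= n)%nat -> a <= xi i <= b)
    by (intros; apply grid_point_bounds; auto; unfold n; lia).
  assert (Hyj : forall i, (i <= n)%nat -> c <= yj i <= d)
    by (intros; apply grid_point_bounds; auto; unfold n; lia).
  assert (x0 : xi O = a) by (unfold xi; simpl; ring).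
  assert (y0 : yj O = c) by (unfold yj; simpl; ring).
  assert (xn : xi n = b) by (unfold xi, hx; field; lra).
  assert (yn : yj n = d) by (unfold yj, hy; field; lra).
  apply (grid_crossing n (fun i j => bool_of (P (xi i) (yj j)))
           (fun i j => bool_of (Q (xi i) (yj j)))).
  - intros j Hj. apply bool_true. rewrite x0. auto.
  - intros j Hj. apply bool_false. rewrite xn. auto.
  - intros i Hi. apply bool_true. rewrite y0. auto.
  - intros i Hi. apply bool_false. rewrite yn. auto.
  - intros i j Hi Hj.
    apply NNPP. intros Hmixed.
    apply (Hm (xi i) (yj j)); [apply Hxi; lia | apply Hyj; lia |].
    intros (u & v & Hu & Hv & Hxu & Hyv & Hdm).
    assert (Hx1 : xi (S i) = xi i + hx) by (unfold xi; rewrite S_INR; ring).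
    assert (Hy1 : yj (S j) = yj j + hy) by (unfold yj; rewrite S_INR; ring).
    assert (Hnear : forall i' j', (i' = i \/ i' = S i) -> (j' = j \/ j' = S j) ->
       dom (xi i') (yj j') /\ Rabs (xi i' - u) < 2 * delta u v /\
       Rabs (yj j' - v) < 2 * delta u v).
    { intros i' j' Hi' Hj'. apply Rabs_def2 in Hxu. apply Rabs_def2 in Hyv.
      split; [split; [apply Hxi | apply Hyj]; lia|].
      split; apply Rabs_def1; destruct Hi' as [-> | ->], Hj' as [-> | ->]; lra. }
    assert (Hconst : forall S : R -> R -> Prop, settled dom S u v (2 * delta u v) ->
      let s i j := bool_of (S (xi i) (yj j)) in
      same4 (s i j) (s (Datatypes.S i) j) (s i (Datatypes.S j))
            (s (Datatypes.S i) (Datatypes.S j))).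
    { intros S [HS | HS] s; unfold same4, s.
      - rewrite !bool_true by (apply HS, Hnear; auto). auto.
      - rewrite !bool_false by (apply HS, Hnear; auto). auto. }
    apply Hmixed.
    destruct (Hdelta u v) as [HP | HQ]; [split; assumption | |].
    + left. apply (Hconst P HP).
    + right. apply (Hconst Q HQ).
Qed.

(** * The radial Volterra operator *)

Definition cont (f : R -> R) : Prop := forall t, continuous f t.

Lemma cont_RInt (f : R -> R) (a b : R) : cont f -> ex_RInt f a b.
Proof. intros Hf. apply @ex_RInt_continuous. intros; apply Hf. Qed.

Lemma cont_mult (f g : R -> R) : cont f -> cont g -> cont (fun t => f t * g t).
Proof. intros Hf Hg t. apply @continuous_mult; auto. Qed.

Lemma cont_plus (f g : R -> R) : cont f -> cont g -> cont (fun t => f t + g t).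
Proof. intros Hf Hg t. apply @continuous_plus; auto. Qed.

Lemma cont_minus (f g : R -> R) : cont f -> cont g -> cont (fun t => f t - g t).
Proof. intros Hf Hg t. apply @continuous_minus; auto. Qed.

Lemma cont_const (c : R) : cont (fun _ => c).
Proof. intros t. apply continuous_const. Qed.

Lemma cont_of_derive (f : R -> R) : (forall t, ex_derive f t) -> cont f.
Proof. intros H t. apply @ex_derive_continuous, H. Qed.

Lemma cont_pow (p : nat) : cont (fun t => t ^ p).
Proof. apply cont_of_derive. intros t. auto_derive. auto. Qed.

Lemma cont_Rabs (f : R -> R) : cont f -> cont (fun t => Rabs (f t)).
Proof. intros Hf t. apply (continuous_comp f Rabs); [apply Hf | apply continuous_Rabs]. Qed.

Lemma cont_exp (K : R) : cont (fun t => exp (K * t)).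
Proof. apply cont_of_derive. intros t. auto_derive. auto. Qed.

Lemma cont_pt (f : R -> R) (t : R) : cont f -> continuity_pt f t.
Proof. intros Hf. apply continuity_pt_filterlim, Hf. Qed.

#[local] Hint Resolve cont_mult cont_plus cont_minus cont_const cont_pow cont_Rabs
  cont_exp cont_RInt : cont.

Lemma exp_nondecreasing (x y : R) : x <= y -> exp x <= exp y.
Proof. intros [H | ->]; [left; now apply exp_increasing | lra]. Qed.

Lemma derive_RInt_cont (f : R -> R) (r : R) :
  cont f -> is_derive (fun x => RInt f 0 x) r (f r).
Proof.
  intros Hf. apply is_derive_RInt with (a := 0); [|apply Hf].
  exists (mkposreal 1 Rlt_0_1). intros y _. apply @RInt_correct, cont_RInt, Hf.
Qed.

(** [potential p phi] is the solution of [(r^p u')' = r^p phi] with [u 0 = 0] and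
    [u' 0 = 0]; [flux] is [u'] and [mass] is [r^p u'].  At [r = 0] the quotient in
    [flux] has the right value 0, since [mass] vanishes there. *)
Definition mass (p : nat) (phi : R -> R) (s : R) : R := RInt (fun t => t ^ p * phi t) 0 s.
Definition flux (p : nat) (phi : R -> R) (s : R) : R := / s ^ p * mass p phi s.
Definition potential (p : nat) (phi : R -> R) (r : R) : R := RInt (flux p phi) 0 r.

Lemma mass_0 (p : nat) (phi : R -> R) : mass p phi 0 = 0.
Proof. unfold mass. now rewrite RInt_point. Qed.

Lemma derive_mass (p : nat) (phi : R -> R) (s : R) :
  cont phi -> is_derive (mass p phi) s (s ^ p * phi s).
Proof. intros H. apply (derive_RInt_cont (fun t => t ^ p * phi t)). auto with cont. Qed.

Lemma Rabs_RInt_le (f : R -> R) (a b M : R) : cont f ->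
  (forall t, Rmin a b <= t <= Rmax a b -> Rabs (f t) <= M) ->
  Rabs (RInt f a b) <= Rabs (b - a) * M.
Proof.
  intros Hf HM. apply (norm_RInt_le_const_abs f a b); [exact HM|].
  apply @RInt_correct, cont_RInt, Hf.
Qed.

(** The weight satisfies [t^p <= s^p] for [t] between 0 and [s], so the singular
    factor [/ s^p] costs nothing. *)
Lemma flux_abs_le (p : nat) (phi : R -> R) (s c : R) :
  cont phi -> (forall t, Rmin 0 s <= t <= Rmax 0 s -> Rabs (phi t) <= c) ->
  Rabs (flux p phi s) <= Rabs s * c.
Proof.
  intros Hphi Hc. unfold flux.
  assert (0 <= c).
  { apply Rle_trans with (1 := Rabs_pos (phi 0)). apply Hc.
    split; [apply Rmin_l | apply Rmax_l]. }
  destruct (Req_dec s 0) as [-> | Hs].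
  { rewrite mass_0, Rmult_0_r, Rabs_R0. lra. }
  assert (Hp : 0 < Rabs s ^ p) by (apply pow_lt, Rabs_pos_lt, Hs).
  assert (Hm : Rabs (mass p phi s) <= Rabs (s - 0) * (Rabs s ^ p * c)).
  { apply Rabs_RInt_le; [auto with cont|]. intros t Ht.
    rewrite Rabs_mult, <- RPow_abs. apply Rmult_le_compat; auto using Rabs_pos.
    - apply pow_le, Rabs_pos.
    - apply pow_incr. split; [apply Rabs_pos|]. revert Ht.
      unfold Rmin, Rmax, Rabs. destruct Rle_dec, Rcase_abs, Rcase_abs; lra. }
  rewrite Rminus_0_r in Hm.
  rewrite Rabs_mult, Rabs_inv, <- RPow_abs.
  apply Rle_trans with (/ Rabs s ^ p * (Rabs s * (Rabs s ^ p * c))).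
  - apply Rmult_le_compat_l; [|exact Hm]. left. now apply Rinv_0_lt_compat.
  - right. field. lra.
Qed.

(** Away from 0 this is continuity of a quotient; at 0 it is [flux_abs_le], which
    gives [flux = O(s)]. *)
Lemma flux_cont (p : nat) (phi : R -> R) : cont phi -> cont (flux p phi).
Proof.
  intros Hphi s. destruct (Req_dec s 0) as [-> | Hs].
  - apply filterlim_locally. intros eps.
    destruct (proj1 (filterlim_locally _ _) (Hphi 0) (mkposreal 1 Rlt_0_1)) as [d Hd].
    set (c := Rabs (phi 0) + 1).
    assert (Hc : 0 < c) by (unfold c; pose proof (Rabs_pos (phi 0)); lra).
    assert (He : 0 < Rmin d (eps / c)).
    { apply Rmin_pos; [apply cond_pos|]. apply Rdiv_lt_0_compat; [apply cond_pos|exact Hc]. }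
    exists (mkposreal _ He). intros y Hy.
    change (Rabs (y - 0) < Rmin d (eps / c)) in Hy. rewrite Rminus_0_r in Hy.
    change (Rabs (flux p phi y - flux p phi 0) < eps).
    replace (flux p phi 0) with 0.
    2:{ unfold flux. now rewrite mass_0, Rmult_0_r. }
    rewrite Rminus_0_r.
    apply Rle_lt_trans with (Rabs y * c).
    + apply flux_abs_le; [exact Hphi|]. intros t Ht.
      assert (Hty : Rabs (t - 0) < d).
      { apply Rle_lt_trans with (Rabs y).
        - revert Ht. unfold Rmin, Rmax, Rabs. destruct Rle_dec, Rcase_abs, Rcase_abs; lra.
        - apply Rlt_le_trans with (1 := Hy), Rmin_l. }
      specialize (Hd t Hty). change (Rabs (phi t - phi 0) < 1) in Hd.
      unfold c. pose proof (Rabs_triang (phi t - phi 0) (phi 0)) as Ht3.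
      replace (phi t - phi 0 + phi 0) with (phi t) in Ht3 by ring. lra.
    + apply Rlt_le_trans with (eps / c * c).
      * apply Rmult_lt_compat_r; [exact Hc|].
        apply Rlt_le_trans with (1 := Hy), Rmin_r.
      * right. field. lra.
  - apply @continuous_mult.
    + apply @ex_derive_continuous. auto_derive. apply pow_nonzero, Hs.
    + apply @ex_derive_continuous. eexists. apply derive_mass, Hphi.
Qed.

Lemma derive_flux (p : nat) (phi : R -> R) (s : R) : cont phi -> 0 < s ->
  is_derive (flux p phi) s (phi s - INR p / s * flux p phi s).
Proof.
  intros Hphi Hs. unfold flux.
  evar_last.
  - apply @is_derive_mult with (f := fun s => / s ^ p) (g := mass p phi).
    + auto_derive; [|reflexivity]. apply pow_nonzero; lra.
    + apply derive_mass, Hphi.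
    + intros; apply Rmult_comm.
  - unfold plus, mult; simpl. assert (s ^ p <> 0) by (apply pow_nonzero; lra).
    destruct p as [|p].
    + simpl. field. lra.
    + rewrite S_INR. simpl pred. simpl in *. field. split; [|lra].
      apply pow_nonzero; lra.
Qed.

Lemma derive_potential (p : nat) (phi : R -> R) (r : R) :
  cont phi -> is_derive (potential p phi) r (flux p phi r).
Proof. intros H. apply derive_RInt_cont, flux_cont, H. Qed.

Lemma potential_cont (p : nat) (phi : R -> R) : cont phi -> cont (potential p phi).
Proof.
  intros H. apply cont_of_derive. intros t. eexists. now apply derive_potential.
Qed.

Lemma RInt_cont_minus (f g : R -> R) (a b : R) : cont f -> cont g ->
  RInt (fun t => f t - g t) a b = RInt f a b - RInt g a b.
Proof. intros Hf Hg. apply (RInt_minus f g); auto with cont. Qed.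

Lemma flux_minus (p : nat) (phi psi : R -> R) (s : R) : cont phi -> cont psi ->
  flux p (fun t => phi t - psi t) s = flux p phi s - flux p psi s.
Proof.
  intros Hphi Hpsi. unfold flux, mass.
  rewrite <- Rmult_minus_distr_l, <- RInt_cont_minus by auto with cont.
  f_equal. apply RInt_ext. intros t _. apply Rmult_minus_distr_l.
Qed.

Lemma potential_minus (p : nat) (phi psi : R -> R) (r : R) : cont phi -> cont psi ->
  potential p (fun t => phi t - psi t) r = potential p phi r - potential p psi r.
Proof.
  intros Hphi Hpsi. unfold potential.
  rewrite <- RInt_cont_minus by (apply flux_cont; assumption).
  apply RInt_ext. intros. now apply flux_minus.
Qed.

Lemma potential_0 (p : nat) (phi : R -> R) : potential p phi 0 = 0.
Proof. unfold potential. now rewrite RInt_point. Qed.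

Lemma potential_abs_le (p : nat) (phi : R -> R) (r rad c : R) :
  cont phi -> 0 <= r <= rad -> (forall t, 0 <= t <= r -> Rabs (phi t) <= c) ->
  Rabs (potential p phi r) <= r * (rad * c).
Proof.
  intros Hphi Hr Hc.
  assert (0 <= c) by (apply Rle_trans with (1 := Rabs_pos (phi 0)), Hc; lra).
  replace r with (Rabs (r - 0)) at 2 by (rewrite Rminus_0_r, Rabs_pos_eq; lra).
  apply Rabs_RInt_le; [now apply flux_cont|].
  rewrite Rmin_left, Rmax_right by lra. intros t Ht.
  apply Rle_trans with (Rabs t * c).
  - apply flux_abs_le; [exact Hphi|]. rewrite Rmin_left, Rmax_right by lra.
    intros; apply Hc; lra.
  - rewrite Rabs_pos_eq by lra. nra.
Qed.

Lemma potential_weighted_le (p : nat) (phi : R -> R) (K c rad r : R) :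
  cont phi -> 0 < K -> 0 <= r <= rad ->
  (forall t, 0 <= t <= rad -> Rabs (phi t) <= c * exp (K * t)) ->
  Rabs (potential p phi r) <= rad * c / K * exp (K * r).
Proof.
  intros Hphi HK Hr Hc.
  assert (Hc0 : 0 <= c).
  { pose proof (Hc 0 ltac:(lra)) as H. rewrite Rmult_0_r, exp_0 in H.
    pose proof (Rabs_pos (phi 0)). lra. }
  apply Rle_trans with (RInt (fun t => Rabs (flux p phi t)) 0 r).
  { apply abs_RInt_le; [lra|]. now apply cont_RInt, flux_cont. }
  apply Rle_trans with (RInt (fun t => rad * c * exp (K * t)) 0 r).
  - apply RInt_le; [lra | | |].
    + apply cont_RInt, cont_Rabs, flux_cont, Hphi.
    + auto with cont.
    + intros s Hs. apply Rle_trans with (Rabs s * (c * exp (K * s))).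
      * apply flux_abs_le; [exact Hphi|]. rewrite Rmin_left, Rmax_right by lra.
        intros t Ht. apply Rle_trans with (1 := Hc t ltac:(lra)).
        apply Rmult_le_compat_l; [exact Hc0|]. apply exp_nondecreasing. nra.
      * rewrite Rabs_pos_eq by lra. rewrite Rmult_assoc.
        apply Rmult_le_compat_r; [|lra].
        apply Rmult_le_pos; [exact Hc0 | left; apply exp_pos].
  - rewrite (is_RInt_unique _ 0 r
      (minus (rad * c / K * exp (K * r)) (rad * c / K * exp (K * 0)))).
    + unfold minus, plus, opp; simpl. rewrite Rmult_0_r, exp_0.
      assert (0 <= rad * c / K) by (apply Rdiv_le_0_compat; nra). lra.
    + apply (is_RInt_derive (fun t => rad * c / K * exp (K * t))).
      * intros t _. auto_derive; [auto|]. field. lra.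
      * intros t _. apply (cont_mult (fun _ => rad * c)); auto with cont.
Qed.

(** The rate [K] of the weight [exp (K * r)] on [0, rad] in which the Volterra operator with
    an [L]-Lipschitz source has norm [rad * L / K <= 1 / 2]. *)
Definition growth (rad L : R) : R := 2 * rad * L + 1.

Lemma growth_pos (rad L : R) : 0 < rad -> 0 <= L -> 0 < growth rad L.
Proof. unfold growth. nra. Qed.

Lemma exp_growth_ge_1 (rad L r : R) : 0 < rad -> 0 <= L -> 0 <= r ->
  1 <= exp (growth rad L * r).
Proof.
  intros. rewrite <- exp_0. apply exp_nondecreasing. pose proof (growth_pos rad L). nra.
Qed.

Lemma potential_contracts (p : nat) (phi : R -> R) (rad L w r : R) :
  cont phi -> 0 < rad -> 0 <= L -> 0 <= w -> 0 <= r <= rad ->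
  (forall t, 0 <= t <= rad -> Rabs (phi t) <= L * (w * exp (growth rad L * t))) ->
  Rabs (potential p phi r) <= w / 2 * exp (growth rad L * r).
Proof.
  intros Hphi Hrad HL Hw Hr H. pose proof (growth_pos rad L Hrad HL) as HK.
  apply Rle_trans with (rad * (L * w) / growth rad L * exp (growth rad L * r)).
  - apply potential_weighted_le; auto. intros t Ht. rewrite Rmult_assoc. auto.
  - apply Rmult_le_compat_r; [left; apply exp_pos|].
    apply Rle_div_l; [exact HK|]. unfold growth. nra.
Qed.

(** Let [w] be the maximum of [|D r| * exp (- K * r)].  At the point where it is
    attained the operator returns at most half of it, which bounds [w] by [2 * c]. *)
Lemma volterra_gronwall (p : nat) (D phi : R -> R) (rad L c : R) :
  cont D -> cont phi -> 0 < rad -> 0 <= L ->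
  (forall t, 0 <= t <= rad -> Rabs (phi t) <= L * Rabs (D t)) ->
  (forall r, 0 <= r <= rad -> Rabs (D r) <= c + Rabs (potential p phi r)) ->
  forall r, 0 <= r <= rad -> Rabs (D r) <= 2 * c * exp (growth rad L * r).
Proof.
  intros HD Hphi Hrad HL HDphi Hineq.
  set (K := growth rad L) in *.
  set (f := fun t => Rabs (D t) * exp (- K * t)).
  destruct (continuity_ab_maj f 0 rad) as [x [Hmax Hx]]; [lra| |].
  { intros t _. apply cont_pt. unfold f. auto with cont. }
  set (w := f x) in *.
  assert (Hexp : forall t, exp (- K * t) * exp (K * t) = 1).
  { intros t. rewrite <- exp_plus. replace (- K * t + K * t) with 0 by ring. apply exp_0. }
  assert (HDf : forall t, Rabs (D t) = f t * exp (K * t)).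
  { intros t. unfold f. rewrite Rmult_assoc, Hexp. ring. }
  assert (Hw : 0 <= w).
  { unfold w, f. apply Rmult_le_pos; [apply Rabs_pos | left; apply exp_pos]. }
  assert (HDw : forall t, 0 <= t <= rad -> Rabs (D t) <= w * exp (K * t)).
  { intros t Ht. rewrite HDf. apply Rmult_le_compat_r; [left; apply exp_pos | auto]. }
  assert (Hxw : w * exp (K * x) <= c + w / 2 * exp (K * x)).
  { unfold w at 1. rewrite <- HDf. apply Rle_trans with (1 := Hineq x Hx).
    apply Rplus_le_compat_l. apply potential_contracts; auto.
    intros t Ht. apply Rle_trans with (1 := HDphi t Ht).
    apply Rmult_le_compat_l; auto. }
  assert (H1 : 1 <= exp (K * x)) by (apply exp_growth_ge_1; lra).
  intros r Hr. apply Rle_trans with (1 := HDw r Hr).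
  apply Rmult_le_compat_r; [left; apply exp_pos|]. nra.
Qed.

(** * Regular solutions of the singular initial value problem *)

Definition lipschitz_source (F : R -> R -> R) (L : R) : Prop :=
  (forall B, cont B -> cont (fun t => F t (B t))) /\
  (forall t, F t 0 = 0) /\
  (forall t b b', Rabs (F t b - F t b') <= L * Rabs (b - b')).

Fixpoint picard (p : nat) (F : R -> R -> R) (a : R) (n : nat) (r : R) : R :=
  match n with
  | O => 0
  | S k => a + potential p (fun t => F t (picard p F a k t)) r
  end.

Lemma picard_cont (p : nat) (F : R -> R -> R) (L a : R) (n : nat) :
  lipschitz_source F L -> cont (picard p F a n).
Proof.
  intros (HF & _ & _). induction n as [|n IH]; simpl; [apply cont_const|].
  apply cont_plus; [apply cont_const|]. apply potential_cont, HF, IH.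
Qed.

(** The operator halves the distance in the weighted norm; the first step goes
    from the zero function to the constant [a]. *)
Lemma picard_step (p : nat) (F : R -> R -> R) (L rad a : R) (n : nat) (r : R) :
  lipschitz_source F L -> 0 < rad -> 0 <= L -> 0 <= r <= rad ->
  Rabs (picard p F a (S n) r - picard p F a n r)
    <= Rabs a * (1 / 2) ^ n * exp (growth rad L * r).
Proof.
  intros HF Hrad HL. revert r. induction n as [|n IH]; intros r Hr.
  - simpl picard. destruct HF as (HFc & HF0 & _).
    assert (Hz : Rabs (potential p (fun t => F t 0) r) <= r * (rad * 0)).
    { apply potential_abs_le; [apply (HFc _ (cont_const 0)) | exact Hr |].
      intros t _. rewrite HF0, Rabs_R0. lra. }
    apply Rabs_le_between in Hz.
    replace (a + potential p (fun t => F t 0) r - 0) with a by lra.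
    pose proof (exp_growth_ge_1 rad L r Hrad HL (proj1 Hr)).
    pose proof (Rabs_pos a). nra.
  - pose proof (picard_cont p F L a n HF) as Hc1.
    pose proof (picard_cont p F L a (S n) HF) as Hc2.
    destruct HF as (HFc & HF0 & HFL).
    replace (picard p F a (S (S n)) r - picard p F a (S n) r) with
      (potential p (fun t => F t (picard p F a (S n) t) - F t (picard p F a n t)) r).
    2:{ rewrite potential_minus by auto. simpl. ring. }
    replace (Rabs a * (1 / 2) ^ S n) with (Rabs a * (1 / 2) ^ n / 2) by (simpl; field).
    apply potential_contracts; auto.
    + auto with cont.
    + apply Rmult_le_pos; [apply Rabs_pos | apply pow_le; lra].
    + intros t Ht. apply Rle_trans with (1 := HFL _ _ _).
      apply Rmult_le_compat_l; auto.
Qed.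

Lemma geometric_limit (u : nat -> R) (c : R) :
  (forall n, Rabs (u (S n) - u n) <= c * (1 / 2) ^ n) ->
  forall n, Rabs (real (Lim_seq u) - u n) <= 2 * c * (1 / 2) ^ n.
Proof.
  intros Hu.
  assert (Hhalf : forall n, 0 < (1 / 2) ^ n) by (intros; apply pow_lt; lra).
  assert (Hc : 0 <= c).
  { pose proof (Hu O) as H. pose proof (Rabs_pos (u 1%nat - u O)). simpl in H. lra. }
  assert (Hk : forall n k, Rabs (u (n + k)%nat - u n) <= 2 * c * (1 / 2) ^ n * (1 - (1 / 2) ^ k)).
  { intros n. induction k as [|k IH].
    - rewrite Nat.add_0_r, Rminus_diag, Rabs_R0. simpl. lra.
    - rewrite Nat.add_succ_r. specialize (Hu (n + k)%nat). rewrite pow_add in Hu.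
      pose proof (Rabs_triang (u (S (n + k)) - u (n + k)%nat) (u (n + k)%nat - u n)) as Ht.
      replace (u (S (n + k)) - u (n + k)%nat + (u (n + k)%nat - u n))
        with (u (S (n + k)) - u n) in Ht by ring.
      simpl pow. lra. }
  assert (Hk' : forall n k, Rabs (u (n + k)%nat - u n) <= 2 * c * (1 / 2) ^ n).
  { intros n k. apply Rle_trans with (1 := Hk n k).
    pose proof (Hhalf n). pose proof (Hhalf k).
    assert (0 <= 2 * c * (1 / 2) ^ n) by (apply Rmult_le_pos; lra). nra. }
  assert (Hlim : is_lim_seq u (real (Lim_seq u))).
  { assert (H : ex_finite_lim_seq u).
    { apply ex_lim_seq_cauchy_corr. intros eps.
      destruct (pow_lt_1_zero (1 / 2) ltac:(rewrite Rabs_pos_eq; lra)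
        (eps / (4 * c + 1))) as [N HN].
      { apply Rdiv_lt_0_compat; [apply cond_pos | lra]. }
      exists N. intros n m Hn Hm.
      specialize (HN N (Nat.le_refl N)). rewrite Rabs_pos_eq in HN by (left; apply Hhalf).
      pose proof (Hk' N (n - N)%nat) as H1. pose proof (Hk' N (m - N)%nat) as H2.
      replace (N + (n - N))%nat with n in H1 by lia.
      replace (N + (m - N))%nat with m in H2 by lia.
      apply Rle_lt_trans with (4 * c * (1 / 2) ^ N).
      - replace (u n - u m) with ((u n - u N) - (u m - u N)) by ring.
        apply Rle_trans with (1 := Rabs_triang _ _). rewrite Rabs_Ropp. lra.
      - assert (eps / (4 * c + 1) * (4 * c + 1) = eps) by (field; lra).
        pose proof (Hhalf N). nra. }
    destruct H as [l Hl]. rewrite (is_lim_seq_unique _ _ Hl). exact Hl. }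
  intros n. set (l := real (Lim_seq u)) in *.
  apply (is_lim_seq_le (fun k => Rabs (u (k + n)%nat - u n)) (fun _ => 2 * c * (1 / 2) ^ n)
    (Rabs (l - u n)) (2 * c * (1 / 2) ^ n)).
  - intros k. rewrite Nat.add_comm. apply Hk'.
  - apply (is_lim_seq_abs _ (l - u n)). apply is_lim_seq_minus'.
    + now apply is_lim_seq_incr_n.
    + apply is_lim_seq_const.
  - apply is_lim_seq_const.
Qed.

(** The iterates converge on [0, rad] only; composing with [clamp] makes the limit
    a continuous function on the whole line. *)
Definition clamp (rad r : R) : R := Rmax 0 (Rmin r rad).

Lemma clamp_range (rad r : R) : 0 < rad -> 0 <= clamp rad r <= rad.
Proof. intros. unfold clamp, Rmax, Rmin. repeat destruct Rle_dec; lra. Qed.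

Lemma clamp_id (rad r : R) : 0 <= r <= rad -> clamp rad r = r.
Proof. intros. unfold clamp, Rmax, Rmin. repeat destruct Rle_dec; lra. Qed.

Lemma clamp_cont (rad : R) : 0 < rad -> cont (clamp rad).
Proof.
  intros Hrad x. apply filterlim_locally. intros eps. exists eps. intros y Hy.
  change (Rabs (clamp rad y - clamp rad x) < eps).
  change (Rabs (y - x) < eps) in Hy. revert Hy.
  unfold clamp, Rmax, Rmin, Rabs.
  repeat destruct Rle_dec; repeat destruct Rcase_abs; lra.
Qed.

Lemma uniform_limit_cont (u : nat -> R -> R) (l : R -> R) (c : R) :
  (forall n, cont (u n)) -> (forall n r, Rabs (l r - u n r) <= c * (1 / 2) ^ n) -> cont l.
Proof.
  intros Hu Hl x. apply filterlim_locally. intros eps.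
  assert (Hc : 0 <= c).
  { pose proof (Hl O x) as H. simpl in H. pose proof (Rabs_pos (l x - u O x)). lra. }
  destruct (pow_lt_1_zero (1 / 2) ltac:(rewrite Rabs_pos_eq; lra)
    (eps / (3 * c + 3))) as [N HN].
  { apply Rdiv_lt_0_compat; [apply cond_pos | lra]. }
  specialize (HN N (Nat.le_refl N)).
  rewrite Rabs_pos_eq in HN by (apply pow_le; lra).
  assert (Hsmall : c * (1 / 2) ^ N <= eps / 3).
  { assert (eps / (3 * c + 3) * (3 * c + 3) = eps) by (field; lra).
    assert (0 < (1 / 2) ^ N) by (apply pow_lt; lra). pose proof (cond_pos eps). nra. }
  assert (He : 0 < eps / 3) by (pose proof (cond_pos eps); lra).
  destruct (proj1 (filterlim_locally _ _) (Hu N x) (mkposreal _ He)) as [d Hd].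
  exists d. intros y Hy. specialize (Hd y Hy).
  change (Rabs (u N y - u N x) < eps / 3) in Hd.
  change (Rabs (l y - l x) < eps).
  pose proof (Hl N x) as H1. pose proof (Hl N y) as H2.
  apply Rabs_def2 in Hd. apply Rabs_le_between in H1. apply Rabs_le_between in H2.
  apply Rabs_def1; lra.
Qed.

(** [B] and [phi] live on the whole line, so that [B] is differentiable also at the
    ends of [0, rad]; the equation [(r^p B')' = r^p F r (B r)] with [B 0 = a] and
    [B' 0 = 0] is imposed on [0, rad] only, where [phi] is its source. *)
Definition regular_profile (p : nat) (F : R -> R -> R) (rad a : R) (B phi : R -> R) : Prop :=
  cont phi /\ (forall r, B r = a + potential p phi r) /\
  (forall r, 0 <= r <= rad -> phi r = F r (B r)).

Lemma regular_profile_exists (p : nat) (F : R -> R -> R) (rad L a : R) :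
  lipschitz_source F L -> 0 < rad -> 0 <= L ->
  exists B phi, regular_profile p F rad a B phi.
Proof.
  intros HF Hrad HL.
  set (c := Rabs a * exp (growth rad L * rad)).
  set (u := fun n r => picard p F a n (clamp rad r)).
  set (b := fun r => real (Lim_seq (fun n => u n r))).
  assert (Hub : forall n r, Rabs (b r - u n r) <= 2 * c * (1 / 2) ^ n).
  { intros n r. apply (geometric_limit (fun n => u n r)). intros k.
    pose proof (clamp_range rad r Hrad) as Hr.
    apply Rle_trans with (1 := picard_step p F L rad a k _ HF Hrad HL Hr).
    replace (c * (1 / 2) ^ k) with (Rabs a * (1 / 2) ^ k * exp (growth rad L * rad))
      by (unfold c; ring).
    apply Rmult_le_compat_l.
    { apply Rmult_le_pos; [apply Rabs_pos | apply pow_le; lra]. }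
    apply exp_nondecreasing. pose proof (growth_pos rad L). nra. }
  assert (Hu : forall n, cont (u n)).
  { intros n x. apply (continuous_comp (clamp rad) (picard p F a n)).
    - now apply clamp_cont.
    - now apply picard_cont with L. }
  assert (Hb : cont b) by now apply (uniform_limit_cont u) with (2 * c).
  pose proof (fun n => picard_cont p F L a n HF) as Hpic.
  destruct HF as (HFc & HF0 & HFL).
  exists (fun r => a + potential p (fun t => F t (b t)) r), (fun t => F t (b t)).
  split; [now apply HFc|]. split; [reflexivity|].
  intros r Hr. f_equal.
  assert (Hc : 0 <= c) by (apply Rmult_le_pos; [apply Rabs_pos | left; apply exp_pos]).
  clearbody c.
  assert (Hclose : forall n,
    Rabs (b r - (a + potential p (fun t => F t (b t)) r))
      <= (2 * c + rad * (rad * (L * (2 * c)))) * (1 / 2) ^ n).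
  { intros n.
    replace (b r - (a + potential p (fun t => F t (b t)) r)) with
      ((b r - u (S n) r) - potential p (fun t => F t (b t) - F t (picard p F a n t)) r).
    2:{ rewrite potential_minus by auto. unfold u. rewrite clamp_id by exact Hr.
        simpl. ring. }
    assert (Hn : 0 < (1 / 2) ^ n) by (apply pow_lt; lra).
    apply Rle_trans with (1 := Rabs_triang _ _). rewrite Rabs_Ropp.
    rewrite Rmult_plus_distr_r. apply Rplus_le_compat.
    - apply Rle_trans with (1 := Hub (S n) r). simpl pow.
      assert (0 <= c * (1 / 2) ^ n) by (apply Rmult_le_pos; lra). lra.
    - apply Rle_trans with (r * (rad * (L * (2 * c * (1 / 2) ^ n)))).
      + apply potential_abs_le; [auto with cont | exact Hr |]. intros t Ht.
        apply Rle_trans with (1 := HFL _ _ _). apply Rmult_le_compat_l; [exact HL|].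
        specialize (Hub n t). unfold u in Hub. rewrite clamp_id in Hub by lra. exact Hub.
      + replace (rad * (rad * (L * (2 * c))) * (1 / 2) ^ n) with
          (rad * (rad * (L * (2 * c * (1 / 2) ^ n)))) by ring.
        apply Rmult_le_compat_r; [|lra].
        repeat apply Rmult_le_pos; lra. }
  assert (Hzero : Rabs (b r - (a + potential p (fun t => F t (b t)) r)) <= 0).
  { set (C := 2 * c + rad * (rad * (L * (2 * c)))) in *.
    apply (is_lim_seq_le (fun _ => Rabs (b r - (a + potential p (fun t => F t (b t)) r)))
      (fun n => C * (1 / 2) ^ n) (Rabs (b r - (a + potential p (fun t => F t (b t)) r))) 0).
    - exact Hclose.
    - apply is_lim_seq_const.
    - replace (Finite 0) with (Rbar_mult C 0) by (simpl; f_equal; ring).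
      apply is_lim_seq_scal_l, is_lim_seq_geom. rewrite Rabs_pos_eq; lra. }
  pose proof (Rabs_pos (b r - (a + potential p (fun t => F t (b t)) r))) as Hpos.
  apply Rminus_diag_uniq. apply Rabs_eq_0. lra.
Qed.

Lemma regular_profile_cont (p : nat) (F : R -> R -> R) (rad a : R) (B phi : R -> R) :
  regular_profile p F rad a B phi -> cont B.
Proof.
  intros (Hphi & HB & _) t.
  apply (continuous_ext (fun r => a + potential p phi r)); [intros; now rewrite HB|].
  apply cont_plus; [apply cont_const | now apply potential_cont].
Qed.

Lemma regular_profile_bound (p : nat) (F : R -> R -> R) (rad L a : R) (B phi : R -> R) :
  lipschitz_source F L -> 0 < rad -> 0 <= L -> regular_profile p F rad a B phi ->
  forall r, 0 <= r <= rad -> Rabs (B r) <= 2 * Rabs a * exp (growth rad L * rad).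
Proof.
  intros (_ & HF0 & HFL) Hrad HL Hreg.
  pose proof (regular_profile_cont p F rad a B phi Hreg) as HBc.
  destruct Hreg as (Hphi & HB & Heq). intros r Hr.
  apply Rle_trans with (2 * Rabs a * exp (growth rad L * r)).
  - apply (volterra_gronwall p B phi); auto.
    + intros t Ht. rewrite Heq by exact Ht. specialize (HFL t (B t) 0).
      now rewrite HF0, !Rminus_0_r in HFL.
    + intros s _. rewrite HB. apply Rabs_triang.
  - apply Rmult_le_compat_l; [pose proof (Rabs_pos a); lra|].
    apply exp_nondecreasing. pose proof (growth_pos rad L). nra.
Qed.

(** The difference of the sources splits as [F1 t (B1 t) - F2 t (B1 t)], which is
    small, plus [F2 t (B1 t) - F2 t (B2 t)], which [volterra_gronwall] absorbs. *)
Lemma regular_profile_stability (p : nat) (F1 F2 : R -> R -> R) (rad L e a1 a2 : R)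
  (B1 B2 phi1 phi2 : R -> R) :
  lipschitz_source F1 L -> lipschitz_source F2 L -> 0 < rad -> 0 <= L ->
  regular_profile p F1 rad a1 B1 phi1 -> regular_profile p F2 rad a2 B2 phi2 ->
  (forall t, 0 <= t <= rad -> Rabs (F1 t (B1 t) - F2 t (B1 t)) <= e) ->
  forall r, 0 <= r <= rad ->
    Rabs (B1 r - B2 r) <= 2 * (Rabs (a1 - a2) + rad * (rad * e)) * exp (growth rad L * rad).
Proof.
  intros (HFc1 & _ & _) (HFc2 & _ & HFL) Hrad HL Hreg1 Hreg2 He r Hr.
  assert (He0 : 0 <= e) by (apply Rle_trans with (2 := He 0 ltac:(lra)), Rabs_pos).
  pose proof (regular_profile_cont _ _ _ _ _ _ Hreg1) as Hc1.
  pose proof (regular_profile_cont _ _ _ _ _ _ Hreg2) as Hc2.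
  destruct Hreg1 as (Hphi1 & HB1 & Heq1), Hreg2 as (Hphi2 & HB2 & Heq2).
  set (mid := fun t => F2 t (B1 t)).
  assert (Hmid : cont mid) by now apply HFc2.
  apply Rle_trans with (2 * (Rabs (a1 - a2) + rad * (rad * e)) * exp (growth rad L * r)).
  - apply (volterra_gronwall p (fun t => B1 t - B2 t) (fun t => mid t - phi2 t));
      auto with cont.
    + intros t Ht. rewrite Heq2 by exact Ht. apply HFL.
    + intros s Hs.
      replace (B1 s - B2 s) with ((a1 - a2) + potential p (fun t => phi1 t - mid t) s
        + potential p (fun t => mid t - phi2 t) s).
      2:{ rewrite HB1, HB2, !potential_minus by assumption. ring. }
      apply Rle_trans with (1 := Rabs_triang _ _). apply Rplus_le_compat_r.
      apply Rle_trans with (1 := Rabs_triang _ _). apply Rplus_le_compat_l.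
      apply Rle_trans with (s * (rad * e)).
      * apply potential_abs_le; [auto with cont | exact Hs |]. intros t Ht.
        rewrite Heq1 by lra. apply He. lra.
      * apply Rmult_le_compat_r; [|lra]. apply Rmult_le_pos; lra.
  - apply Rmult_le_compat_l.
    + pose proof (Rabs_pos (a1 - a2)).
      assert (0 <= rad * (rad * e)) by (repeat apply Rmult_le_pos; lra). lra.
    + apply exp_nondecreasing. pose proof (growth_pos rad L). nra.
Qed.

Lemma mean_value (f df : R -> R) (x y : R) :
  x <= y -> (forall t, x <= t <= y -> is_derive f t (df t)) ->
  exists c, x <= c <= y /\ f y - f x = df c * (y - x).
Proof.
  intros Hxy Hf. destruct (MVT_gen f x y df) as [c Hc].
  - rewrite Rmin_left, Rmax_right by exact Hxy. intros; apply Hf; lra.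
  - rewrite Rmin_left, Rmax_right by exact Hxy. intros t Ht.
    apply continuity_pt_filterlim. apply @ex_derive_continuous. eexists. apply Hf, Ht.
  - rewrite Rmin_left, Rmax_right in Hc by exact Hxy. now exists c.
Qed.

Lemma inv_nonneg (x : R) : 0 <= x -> 0 <= / x.
Proof.
  intros [H | <-]; [left; now apply Rinv_0_lt_compat | rewrite Rinv_0; lra].
Qed.

Lemma regular_profile_0 (p : nat) (F : R -> R -> R) (rad a : R) (B phi : R -> R) :
  regular_profile p F rad a B phi -> B 0 = a.
Proof. intros (_ & HB & _). rewrite HB, potential_0. ring. Qed.

Lemma regular_profile_derive (p : nat) (F : R -> R -> R) (rad a : R) (B phi : R -> R) (r : R) :
  regular_profile p F rad a B phi -> is_derive B r (flux p phi r).
Proof.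
  intros (Hphi & HB & _).
  apply (is_derive_ext (fun r => a + potential p phi r)); [intros; now rewrite HB|].
  replace (flux p phi r) with (0 + flux p phi r) by ring.
  apply @is_derive_plus; [apply @is_derive_const | now apply derive_potential].
Qed.

Lemma regular_profile_source_le (p : nat) (F : R -> R -> R) (rad L a : R) (B phi : R -> R) (r : R) :
  lipschitz_source F L -> regular_profile p F rad a B phi -> 0 <= r <= rad ->
  Rabs (phi r) <= L * Rabs (B r).
Proof.
  intros (_ & HF0 & HFL) (_ & _ & Heq) Hr. rewrite Heq by exact Hr.
  specialize (HFL r (B r) 0). now rewrite HF0, !Rminus_0_r in HFL.
Qed.

(** At an interior zero the nonnegative [B] has a minimum, so [B'] vanishes too.
    Backwards from there, [(B^2 + B'^2) * exp (K * r)] is nondecreasing on [e, r0]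
    once [K] dominates the Lipschitz constant and the damping [2 * p / r], so it is
    zero on all of (0, r0], and [B 0 = 0] by continuity. *)
Lemma regular_profile_no_interior_zero (p : nat) (F : R -> R -> R) (rad L a : R)
  (B phi : R -> R) (r0 : R) :
  lipschitz_source F L -> 0 <= L -> regular_profile p F rad a B phi ->
  (forall r, 0 <= r <= rad -> 0 <= B r) -> 0 < r0 < rad -> B r0 = 0 -> a = 0.
Proof.
  intros HF HL Hreg Hpos Hr0 HB0.
  pose proof (fun r => regular_profile_derive p F rad a B phi r Hreg) as HdB.
  pose proof (fun r => regular_profile_source_le p F rad L a B phi r HF Hreg) as Hphi_le.
  pose proof (regular_profile_cont p F rad a B phi Hreg) as HBc.
  pose proof (regular_profile_0 p F rad a B phi Hreg) as HBa.
  destruct Hreg as (Hphi & _ & _).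
  assert (Hflux0 : flux p phi r0 = 0).
  { pose proof (proj1 (is_derive_Reals _ _ _) (HdB r0)) as Hd.
    assert (Hz := deriv_minimum B 0 rad r0 (exist _ _ Hd) (proj1 Hr0) (proj2 Hr0)).
    apply Hz. intros x Hx1 Hx2. rewrite HB0. apply Hpos. lra. }
  assert (Hzero : forall e, 0 < e < r0 -> B e = 0).
  { intros e He.
    set (q := 2 * (INR p / e)).
    assert (Hq : 0 <= q).
    { unfold q. apply Rmult_le_pos; [lra|]. apply Rdiv_le_0_compat; [apply pos_INR|lra]. }
    set (K := 1 + L + q).
    destruct (mean_value (fun t => (B t ^ 2 + flux p phi t ^ 2) * exp (K * t))
      (fun t => (2 * (B t * flux p phi t)
         + 2 * (flux p phi t * (phi t - INR p / t * flux p phi t))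
         + K * (B t ^ 2 + flux p phi t ^ 2)) * exp (K * t)) e r0) as [c [Hc Hmv]]; [lra| |].
    { intros t Ht.
      pose proof (HdB t) as H1. pose proof (derive_flux p phi t Hphi ltac:(lra)) as H2.
      assert (E1 : Derive (fun x : R => B x) t = _) by (apply is_derive_unique, H1).
      assert (E2 : Derive (fun x : R => flux p phi x) t = _) by (apply is_derive_unique, H2).
      auto_derive.
      - repeat split; eexists; eassumption.
      - rewrite E1, E2. ring. }
    cbv beta in Hmv. rewrite HB0, Hflux0 in Hmv.
    set (x := B c) in *. set (y := flux p phi c) in *.
    assert (Hpc : INR p / c * y ^ 2 <= q / 2 * y ^ 2).
    { apply Rmult_le_compat_r; [nra|]. unfold q.
      replace (2 * (INR p / e) / 2) with (INR p / e) by (field; lra).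
      apply Rmult_le_compat_l; [apply pos_INR|]. apply Rinv_le_contravar; lra. }
    assert (Hphic : - (L * (x ^ 2 + y ^ 2)) <= 2 * (y * phi c)).
    { pose proof (Hphi_le c ltac:(lra)) as Hle. fold x in Hle.
      assert (Rabs (y * phi c) <= Rabs y * (L * Rabs x)).
      { rewrite Rabs_mult. apply Rmult_le_compat_l; [apply Rabs_pos | exact Hle]. }
      assert (2 * (Rabs y * Rabs x) <= x ^ 2 + y ^ 2).
      { rewrite <- (pow2_abs x), <- (pow2_abs y).
        pose proof (pow2_ge_0 (Rabs x - Rabs y)). nra. }
      pose proof (Rabs_maj2 (y * phi c)). nra. }
    assert (Hnum : 0 <= 2 * (x * y) + 2 * (y * (phi c - INR p / c * y)) + K * (x ^ 2 + y ^ 2)).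
    { unfold K. pose proof (pow2_ge_0 (x + y)). pose proof (pow2_ge_0 x).
      assert (0 <= q * x ^ 2) by (apply Rmult_le_pos; auto). nra. }
    assert (Hexpc := exp_pos (K * c)). assert (Hexpe := exp_pos (K * e)).
    assert (0 <= (2 * (x * y) + 2 * (y * (phi c - INR p / c * y)) + K * (x ^ 2 + y ^ 2))
      * exp (K * c) * (r0 - e)) by (repeat apply Rmult_le_pos; lra).
    assert ((B e ^ 2 + flux p phi e ^ 2) * exp (K * e) <= 0) by (simpl in *; lra).
    pose proof (pow2_ge_0 (B e)). pose proof (pow2_ge_0 (flux p phi e)).
    assert (B e ^ 2 = 0) by nra. nra. }
  apply NNPP. intros Ha. rewrite <- HBa in Ha.
  assert (He : 0 < Rabs (B 0)) by (apply Rabs_pos_lt, Ha).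
  destruct (proj1 (filterlim_locally _ _) (HBc 0) (mkposreal _ He)) as [d Hd].
  pose proof (cond_pos d) as Hd0.
  set (e := Rmin (d / 2) (r0 / 2)).
  assert (0 < e <= d / 2 /\ e <= r0 / 2).
  { unfold e. repeat split; [apply Rmin_pos; lra | apply Rmin_l | apply Rmin_r]. }
  specialize (Hd e). change (Rabs (e - 0) < d -> Rabs (B e - B 0) < Rabs (B 0)) in Hd.
  rewrite Hzero in Hd by lra. rewrite Rminus_0_r, Rminus_0_l, Rabs_Ropp in Hd.
  rewrite Rabs_pos_eq in Hd by lra. lra.
Qed.

(** * Profiles of the vortex equation *)

Definition saturation (x : R) : R := x ^ 2 / (1 + x ^ 2) ^ 2.

Lemma saturation_range (x : R) : 0 <= saturation x <= 1 / 4.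
Proof.
  unfold saturation. assert (0 < (1 + x ^ 2) ^ 2) by (apply pow_lt; nra).
  split.
  - apply Rdiv_le_0_compat; nra.
  - apply Rle_div_l; [assumption|]. pose proof (pow2_ge_0 (x ^ 2 - 1)). nra.
Qed.

Lemma saturation_cont : cont saturation.
Proof.
  apply cont_of_derive. intros x. unfold saturation. auto_derive.
  assert (0 < 1 + x ^ 2) by nra. simpl in *. nra.
Qed.

Definition vortex_source (M : nat) (lambda t b : R) : R :=
  (lambda - saturation (t ^ M * b)) * b.

(** Stated with the factor [k = t ^ M] inside because the constant must not depend
    on [t]: the derivative in [b] is [(3 x^2 - x^4) / (1 + x^2)^3] at [x = k * b]. *)
Lemma saturation_lipschitz (k b b' : R) :
  Rabs (saturation (k * b) * b - saturation (k * b') * b') <= 3 * Rabs (b - b').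
Proof.
  destruct (MVT_gen (fun b => saturation (k * b) * b) b' b
    (fun b => (3 * (k * b) ^ 2 - (k * b) ^ 4) / (1 + (k * b) ^ 2) ^ 3)) as [c [_ Hc]].
  - intros x _. unfold saturation. assert (0 < 1 + (k * x) ^ 2) by nra.
    auto_derive; simpl in *; [nra|]. field. nra.
  - intros x _. apply cont_pt, cont_of_derive. clear x. intros x.
    unfold saturation. assert (0 < 1 + (k * x) ^ 2) by nra.
    auto_derive; simpl in *; nra.
  - rewrite Hc, Rabs_mult. apply Rmult_le_compat_r; [apply Rabs_pos|].
    set (x := k * c). set (s := x ^ 2).
    assert (Hs : 0 <= s) by apply pow2_ge_0.
    replace (x ^ 4) with (s ^ 2) by (unfold s; ring).
    assert (0 < (1 + s) ^ 3) by (apply pow_lt; lra).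
    assert (0 <= s ^ 3) by (apply pow_le; lra).
    assert (0 <= s ^ 2) by (apply pow_le; lra).
    apply Rabs_le. split.
    + apply Rle_div_r; [assumption|]. nra.
    + apply Rle_div_l; [assumption|]. nra.
Qed.

Lemma vortex_source_lipschitz (M : nat) (lambda bound : R) :
  Rabs lambda <= bound -> lipschitz_source (vortex_source M lambda) (bound + 3).
Proof.
  intros Hl. repeat split.
  - intros B HB. unfold vortex_source. apply cont_mult; [|exact HB].
    apply cont_minus; [apply cont_const|]. intros t.
    apply (continuous_comp (fun t => t ^ M * B t) saturation); [|apply saturation_cont].
    apply cont_mult; auto with cont.
  - intros t. unfold vortex_source. ring.
  - intros t b b'. unfold vortex_source.
    replace ((lambda - saturation (t ^ M * b)) * b - (lambda - saturation (t ^ M * b')) * b')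
      with (lambda * (b - b')
        - (saturation (t ^ M * b) * b - saturation (t ^ M * b') * b')) by ring.
    apply Rle_trans with (1 := Rabs_triang _ _). rewrite Rabs_Ropp, Rabs_mult.
    pose proof (saturation_lipschitz (t ^ M) b b'). pose proof (Rabs_pos (b - b')). nra.
Qed.

(** [B * (r^p B')] has derivative [r^p B'^2 + r^p (lambda - V) B^2 >= 0], so
    [B * B' >= 0] and [B^2] never falls below [a^2]. *)
Lemma vortex_profile_positive (p M : nat) (rad lambda a : R) (B phi : R -> R) :
  regular_profile p (vortex_source M lambda) rad a B phi -> 0 < a -> 1 / 4 <= lambda ->
  forall r, 0 <= r <= rad -> 0 < B r.
Proof.
  intros Hreg Ha Hl r Hr.
  pose proof (fun r => regular_profile_derive p _ rad a B phi r Hreg) as HdB.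
  pose proof (regular_profile_cont p _ rad a B phi Hreg) as HBc.
  pose proof (regular_profile_0 p _ rad a B phi Hreg) as HBa.
  destruct Hreg as (Hphi & _ & Heq).
  assert (HBm : forall s, 0 <= s <= rad -> 0 <= B s * mass p phi s).
  { intros s Hs.
    destruct (mean_value (fun t => B t * mass p phi t)
      (fun t => flux p phi t * mass p phi t + B t * (t ^ p * phi t)) 0 s)
      as [c [Hc Hmv]]; [lra| |].
    { intros t _. apply @is_derive_mult; [apply HdB | now apply derive_mass |].
      intros; apply Rmult_comm. }
    rewrite mass_0, Rmult_0_r, !Rminus_0_r in Hmv. rewrite Hmv.
    apply Rmult_le_pos; [|lra].
    assert (Hcp : 0 <= c ^ p) by (apply pow_le; lra).
    apply Rplus_le_le_0_compat.
    - unfold flux. pose proof (inv_nonneg _ Hcp).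
      replace (/ c ^ p * mass p phi c * mass p phi c) with
        (/ c ^ p * mass p phi c ^ 2) by ring.
      apply Rmult_le_pos; [assumption | apply pow2_ge_0].
    - rewrite Heq by lra. unfold vortex_source.
      pose proof (saturation_range (c ^ M * B c)).
      replace (B c * (c ^ p * ((lambda - saturation (c ^ M * B c)) * B c))) with
        (c ^ p * ((lambda - saturation (c ^ M * B c)) * B c ^ 2)) by ring.
      apply Rmult_le_pos; [exact Hcp|]. apply Rmult_le_pos; [lra | apply pow2_ge_0]. }
  assert (HB2 : forall s, 0 <= s <= rad -> a ^ 2 <= B s ^ 2).
  { intros s Hs.
    destruct (mean_value (fun t => B t * B t)
      (fun t => flux p phi t * B t + B t * flux p phi t) 0 s)
      as [c [Hc Hmv]]; [lra| |].
    { intros t _. apply @is_derive_mult; try apply HdB. intros; apply Rmult_comm. }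
    rewrite HBa in Hmv.
    assert (0 <= B c * flux p phi c).
    { unfold flux. assert (Hcp : 0 <= c ^ p) by (apply pow_le; lra).
      pose proof (inv_nonneg _ Hcp). pose proof (HBm c ltac:(lra)).
      replace (B c * (/ c ^ p * mass p phi c)) with (/ c ^ p * (B c * mass p phi c)) by ring.
      now apply Rmult_le_pos. }
    assert (0 <= (flux p phi c * B c + B c * flux p phi c) * (s - 0))
      by (apply Rmult_le_pos; lra).
    simpl. lra. }
  apply Rnot_le_lt. intros Hneg.
  destruct (IVT_gen B 0 r 0) as [x [Hx Hx0]].
  - intros t. now apply cont_pt.
  - rewrite HBa, Rmin_right, Rmax_left by lra. lra.
  - rewrite Rmin_left, Rmax_right in Hx by lra.
    specialize (HB2 x ltac:(lra)). rewrite Hx0 in HB2. nra.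
Qed.

(** If [B] stayed positive, it would be decreasing, and [r^p B'] would be at most
    [- k * (rad/4)^(p+1) * B (rad/2)] from [rad/2] on.  For [k] this large, that
    slope brings [B] to 0 before [rad]. *)
Lemma vortex_profile_vanishes (p M : nat) (rad k a : R) (B phi : R -> R) :
  regular_profile p (vortex_source M (- k)) rad a B phi -> 0 < rad -> 0 < k ->
  rad ^ p <= k * (rad / 4) ^ S p * (rad / 2) ->
  exists r, 0 <= r <= rad /\ B r <= 0.
Proof.
  intros Hreg Hrad Hk Hlarge. apply NNPP. intros Hno.
  assert (Hpos : forall r, 0 <= r <= rad -> 0 < B r).
  { intros r Hr. apply Rnot_le_lt. intros HB. apply Hno. now exists r. }
  pose proof (fun r => regular_profile_derive p _ rad a B phi r Hreg) as HdB.
  destruct Hreg as (Hphi & _ & Heq).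
  assert (Hphile : forall t, 0 <= t <= rad -> phi t <= - (k * B t)).
  { intros t Ht. rewrite Heq by exact Ht. unfold vortex_source.
    pose proof (saturation_range (t ^ M * B t)). pose proof (Hpos t Ht). nra. }
  assert (Hmono : forall x y, 0 <= x <= y -> y <= rad -> mass p phi y <= mass p phi x).
  { intros x y Hx Hy.
    destruct (mean_value (mass p phi) (fun t => t ^ p * phi t) x y) as [c [Hc Hmv]];
      [lra | intros; now apply derive_mass |].
    assert (0 <= c ^ p) by (apply pow_le; lra).
    assert (phi c <= 0).
    { pose proof (Hphile c ltac:(lra)). pose proof (Hpos c ltac:(lra)). nra. }
    assert (0 <= c ^ p * - phi c * (y - x)) by (repeat apply Rmult_le_pos; lra). nra. }
  assert (Hdecr : forall x y, 0 <= x <= y -> y <= rad -> B y <= B x).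
  { intros x y Hx Hy.
    destruct (mean_value B (flux p phi) x y) as [c [Hc Hmv]];
      [lra | intros; apply HdB |].
    pose proof (Hmono 0 c ltac:(lra) ltac:(lra)) as Hm. rewrite mass_0 in Hm.
    assert (0 <= / c ^ p) by (apply inv_nonneg, pow_le; lra).
    assert (0 <= / c ^ p * - mass p phi c * (y - x)) by (repeat apply Rmult_le_pos; lra).
    unfold flux in Hmv. nra. }
  set (h := rad / 2). set (m := k * (rad / 4) ^ S p * B h).
  assert (Hh := Hpos h ltac:(unfold h; lra)).
  assert (Hq : 0 < (rad / 4) ^ p) by (apply pow_lt; lra).
  assert (Hmh : mass p phi h <= - m).
  { destruct (mean_value (mass p phi) (fun t => t ^ p * phi t) (rad / 4) h)
      as [c [Hc Hmv]]; [unfold h; lra | intros; now apply derive_mass |].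
    pose proof (Hmono 0 (rad / 4) ltac:(lra) ltac:(lra)) as Hm0. rewrite mass_0 in Hm0.
    assert (Hcp : (rad / 4) ^ p <= c ^ p) by (apply pow_incr; lra).
    unfold h in Hc.
    assert (HBc : B h <= B c) by (apply Hdecr; unfold h; lra).
    pose proof (Hphile c ltac:(lra)) as Hpc.
    assert (c ^ p * phi c <= - (k * (rad / 4) ^ p * B h)).
    { assert (k * B h <= - phi c) by nra.
      assert (0 <= k * B h) by (apply Rmult_le_pos; lra). nra. }
    unfold m. replace (h - rad / 4) with (rad / 4) in Hmv by (unfold h; field).
    simpl pow. nra. }
  destruct (mean_value B (flux p phi) h rad) as [c [Hc Hmv]];
    [unfold h; lra | intros; apply HdB |].
  assert (Hh0 : 0 < h) by (unfold h; lra).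
  assert (Hcp : 0 < c ^ p) by (apply pow_lt; lra).
  assert (Hcr : c ^ p <= rad ^ p) by (apply pow_incr; lra).
  pose proof (Hmono h c ltac:(lra) ltac:(lra)) as Hmc.
  assert (Hflux : flux p phi c * c ^ p = mass p phi c) by (unfold flux; field; lra).
  assert (Hm : rad ^ p * B h <= m * (rad - h)).
  { unfold m. replace (rad - h) with (rad / 2) by (unfold h; field). nra. }
  pose proof (Hpos rad ltac:(lra)) as Hend.
  assert (Hdrop : B h * c ^ p <= - (flux p phi c * (rad - h)) * c ^ p).
  { replace (- (flux p phi c * (rad - h)) * c ^ p)
      with (- (flux p phi c * c ^ p) * (rad - h)) by ring.
    rewrite Hflux.
    assert (m * (rad - h) <= - mass p phi c * (rad - h))
      by (apply Rmult_le_compat_r; unfold h; lra).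
    assert (B h * c ^ p <= B h * rad ^ p) by (apply Rmult_le_compat_l; lra). lra. }
  apply Rmult_le_reg_r in Hdrop; [|exact Hcp].
  lra.
Qed.

(** * From profiles to the boundary value problem *)

(** The factor [INR n / r * r ^ n] stands for [INR n * r ^ (n - 1)], without the
    truncated exponent. *)
Lemma derive_pow_mult (n : nat) (f : R -> R) (df r : R) : 0 < r -> is_derive f r df ->
  is_derive (fun x => x ^ n * f x) r (INR n / r * r ^ n * f r + r ^ n * df).
Proof.
  intros Hr Hf.
  replace (INR n / r * r ^ n) with (INR n * 1 * r ^ pred n).
  - apply @is_derive_mult; [|exact Hf | intros; apply Rmult_comm].
    apply (is_derive_pow (fun x => x)), @is_derive_id.
  - destruct n as [|n]; [simpl; field; lra|]. simpl pred. simpl pow. field. lra.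
Qed.

(** The substitution [A = r^M B] turns the [M^2 / r^2] term into the first-order
    damping [(2 M + 1) / r * B'], which is why the weight exponent is [2 M + 1]. *)
Lemma vortex_solution_of_profile (m : Z) (rad lambda a : R) (B phi : R -> R) :
  let M := Z.abs_nat m in
  (1 <= Z.abs m)%Z -> 0 < rad ->
  regular_profile (2 * M + 1) (vortex_source M lambda) rad a B phi -> B rad = 0 ->
  solution_pair m rad (fun r => r ^ M * B r) lambda.
Proof.
  intros M Hm Hrad Hreg HBrad.
  pose proof (fun r => regular_profile_derive _ _ rad a B phi r Hreg) as HdB.
  pose proof (regular_profile_cont _ _ rad a B phi Hreg) as HBc.
  destruct Hreg as (Hphi & _ & Heq).
  set (A := fun r => r ^ M * B r). set (p := (2 * M + 1)%nat) in *.
  set (A1 := fun r => INR M / r * A r + r ^ M * flux p phi r).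
  set (A2 := fun r => - (INR M / r ^ 2) * A r + INR M / r * A1 r
    + (INR M / r * r ^ M * flux p phi r
       + r ^ M * (phi r - INR p / r * flux p phi r))).
  assert (HA1 : forall r, 0 < r -> is_derive A r (A1 r)).
  { intros r Hr. unfold A1, A. rewrite <- Rmult_assoc. now apply derive_pow_mult. }
  assert (HA2 : forall r, 0 < r -> is_derive A1 r (A2 r)).
  { intros r Hr. apply @is_derive_plus.
    - apply @is_derive_mult; [|now apply HA1 | intros; apply Rmult_comm].
      auto_derive; [lra|]. field. lra.
    - apply derive_pow_mult; [exact Hr | now apply derive_flux]. }
  assert (Hloc : forall r, 0 < r -> locally r (fun x => A1 x = Derive_n A 1 x)).
  { intros r Hr. exists (mkposreal r Hr). intros y Hy.
    change (Rabs (y - r) < r) in Hy. apply Rabs_def2 in Hy.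
    symmetry. apply is_derive_unique, HA1. lra. }
  assert (HD2 : forall r, 0 < r -> is_derive (Derive_n A 1) r (A2 r)).
  { intros r Hr. apply (is_derive_ext_loc A1); [now apply Hloc | now apply HA2]. }
  assert (HM0 : (0 < M)%nat) by (unfold M; lia).
  repeat split.
  - intros r _. eapply filterlim_filter_le_1; [apply filter_le_within|].
    apply (cont_mult (fun r => r ^ M) B); auto with cont.
  - eexists. apply HA1. lra.
  - eexists. apply HD2. lra.
  - intros r Hr. unfold vortex_equation_at.
    assert (E1 : Derive A r = A1 r) by (apply is_derive_unique, HA1; lra).
    assert (E2 : Derive_n A 2 r = A2 r) by (apply is_derive_unique, HD2; lra).
    rewrite E1, E2.
    replace (IZR m ^ 2) with (INR M ^ 2).
    2:{ unfold M. rewrite INR_IZR_INZ, Zabs2Nat.id_abs, abs_IZR. apply pow2_abs. }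
    unfold A2. rewrite Heq by lra. unfold vortex_source, saturation, A1, A.
    replace (INR p) with (2 * INR M + 1)
      by (unfold p; rewrite plus_INR, mult_INR; simpl; ring).
    set (x := r ^ M). assert (0 < 1 + (x * B r) ^ 2) by nra. simpl in *. field. split; lra.
  - unfold A. rewrite pow_i by exact HM0. ring.
  - unfold A. rewrite HBrad. ring.
Qed.

Lemma photon_integrand_cont (A : R -> R) : cont A -> cont (fun r => r * A r ^ 2).
Proof.
  intros HA. apply (cont_mult (fun r => r)); [intros t; apply continuous_id|].
  simpl. auto with cont.
Qed.

Lemma photon_number_le (rad c : R) (A : R -> R) :
  0 < rad -> cont A -> (forall r, 0 <= r <= rad -> Rabs (A r) <= c) ->
  photon_number rad A <= 2 * PI * (rad * (rad * c ^ 2)).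
Proof.
  intros Hrad HA Hc. unfold photon_number. pose proof PI_RGT_0.
  apply Rmult_le_compat_l; [lra|].
  apply Rle_trans with (1 := Rle_abs _).
  replace rad with (Rabs (rad - 0)) at 2 by (rewrite Rminus_0_r, Rabs_pos_eq; lra).
  apply Rabs_RInt_le.
  - now apply photon_integrand_cont.
  - rewrite Rmin_left, Rmax_right by lra. intros t Ht.
    rewrite Rabs_mult, <- RPow_abs, Rabs_pos_eq by lra.
    apply Rmult_le_compat; try lra.
    + apply pow_le, Rabs_pos.
    + apply pow_incr. split; [apply Rabs_pos | auto].
Qed.

Lemma photon_number_ge (rad x c : R) (A : R -> R) :
  0 < x -> 2 * x <= rad -> 0 <= c -> cont A ->
  (forall r, x <= r <= 2 * x -> c <= A r) ->
  2 * PI * (x * (x * c ^ 2)) <= photon_number rad A.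
Proof.
  intros Hx Hrad Hc HA HAc. unfold photon_number. pose proof PI_RGT_0.
  apply Rmult_le_compat_l; [lra|].
  pose proof (photon_integrand_cont A HA) as Hf.
  set (f := fun r => r * A r ^ 2) in *.
  assert (Hf0 : forall r, 0 <= r -> 0 <= f r).
  { intros r Hr. apply Rmult_le_pos; [exact Hr | apply pow2_ge_0]. }
  rewrite <- (RInt_Chasles f 0 x rad) by (apply cont_RInt, Hf).
  rewrite <- (RInt_Chasles f x (2 * x) rad) by (apply cont_RInt, Hf).
  unfold plus; simpl.
  assert (0 <= RInt f 0 x).
  { apply RInt_ge_0; [lra | now apply cont_RInt |]. intros; apply Hf0; lra. }
  assert (0 <= RInt f (2 * x) rad).
  { apply RInt_ge_0; [lra | now apply cont_RInt |]. intros; apply Hf0; lra. }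
  assert (x * (x * c ^ 2) <= RInt f x (2 * x)).
  { replace (x * (x * c ^ 2)) with (RInt (fun _ => x * c ^ 2) x (2 * x)).
    - apply RInt_le; [lra | apply cont_RInt, cont_const | now apply cont_RInt |].
      intros t Ht. unfold f. apply Rmult_le_compat; try lra; [nra|].
      apply pow_incr. split; [exact Hc | apply HAc; lra].
    - rewrite RInt_const. unfold scal; simpl. unfold mult; simpl. ring. }
  simpl in *. lra.
Qed.

Lemma photon_number_lipschitz (rad c e : R) (A1 A2 : R -> R) :
  0 < rad -> cont A1 -> cont A2 ->
  (forall r, 0 <= r <= rad -> Rabs (A1 r) <= c) ->
  (forall r, 0 <= r <= rad -> Rabs (A2 r) <= c) ->
  (forall r, 0 <= r <= rad -> Rabs (A1 r - A2 r) <= e) ->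
  Rabs (photon_number rad A1 - photon_number rad A2) <= 4 * PI * rad ^ 2 * c * e.
Proof.
  intros Hrad HA1 HA2 Hc1 Hc2 He. unfold photon_number. pose proof PI_RGT_0.
  rewrite <- Rmult_minus_distr_l.
  rewrite <- (RInt_cont_minus (fun r => r * A1 r ^ 2) (fun r => r * A2 r ^ 2))
    by now apply photon_integrand_cont.
  rewrite Rabs_mult, (Rabs_pos_eq (2 * PI)) by lra.
  replace (4 * PI * rad ^ 2 * c * e) with (2 * PI * (Rabs (rad - 0) * (rad * (2 * c * e))))
    by (rewrite Rminus_0_r, Rabs_pos_eq by lra; ring).
  apply Rmult_le_compat_l; [lra|].
  apply Rabs_RInt_le.
  - apply cont_minus; now apply photon_integrand_cont.
  - rewrite Rmin_left, Rmax_right by lra. intros t Ht.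
    replace (t * A1 t ^ 2 - t * A2 t ^ 2) with (t * ((A1 t + A2 t) * (A1 t - A2 t))) by ring.
    rewrite !Rabs_mult, (Rabs_pos_eq t) by lra.
    apply Rmult_le_compat; try lra.
    + apply Rmult_le_pos; apply Rabs_pos.
    + apply Rmult_le_compat; try apply Rabs_pos; [|auto].
      apply Rle_trans with (1 := Rabs_triang _ _).
      pose proof (Hc1 t Ht). pose proof (Hc2 t Ht). lra.
Qed.

(** Where a Lipschitz function differs from [level], it stays on the same side of
    [level] nearby. *)
Lemma unsettled_level (dom : R -> R -> Prop) (g : R -> R -> R) (C level x y : R) :
  0 < C ->
  (forall x' y', dom x' y' ->
     Rabs (g x' y' - g x y) <= C * (Rabs (x' - x) + Rabs (y' - y))) ->
  (forall e, 0 < e -> ~ settled dom (fun x y => g x y < level) x y e) ->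
  g x y = level.
Proof.
  intros HC Hg Hset. apply NNPP. intros Hne.
  set (gap := Rabs (g x y - level)).
  assert (Hgap : 0 < gap) by (apply Rabs_pos_lt; lra).
  assert (He : 0 < gap / (2 * C)) by (apply Rdiv_lt_0_compat; lra).
  assert (HgapC : gap / (2 * C) * (2 * C) = gap) by (field; lra).
  apply (Hset _ He).
  assert (Hclose : forall x' y', dom x' y' /\ Rabs (x' - x) < gap / (2 * C) /\
      Rabs (y' - y) < gap / (2 * C) -> Rabs (g x' y' - g x y) < gap).
  { intros x' y' (Hd & Hx & Hy). apply Rle_lt_trans with (1 := Hg _ _ Hd). nra. }
  destruct (Rlt_or_le (g x y) level) as [Hlt | Hle]; [left | right];
    intros x' y' Hnear; apply Hclose in Hnear; apply Rabs_def2 in Hnear;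
    unfold gap in Hnear; revert Hnear; unfold Rabs; destruct Rcase_abs; lra.
Qed.

(** A negative value survives small changes of the parameters, and so does a
    positive minimum; at a frontier point the minimum is therefore 0. *)
Lemma unsettled_touching (dom : R -> R -> Prop) (g : R -> R -> R -> R) (rad C x y : R) :
  0 < C -> 0 < rad -> cont (g x y) ->
  (forall x' y', dom x' y' -> forall r, 0 <= r <= rad ->
     Rabs (g x' y' r - g x y r) <= C * (Rabs (x' - x) + Rabs (y' - y))) ->
  (forall e, 0 < e ->
     ~ settled dom (fun x y => exists r, 0 <= r <= rad /\ g x y r <= 0) x y e) ->
  (forall r, 0 <= r <= rad -> 0 <= g x y r) /\
  (exists r, 0 <= r <= rad /\ g x y r = 0).
Proof.
  intros HC Hrad Hcont Hg Hset.
  assert (Hclose : forall gap x' y', 0 < gap -> dom x' y' /\ Rabs (x' - x) < gap / (2 * C) /\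
      Rabs (y' - y) < gap / (2 * C) ->
      forall r, 0 <= r <= rad -> Rabs (g x' y' r - g x y r) < gap).
  { intros gap x' y' Hgap (Hd & Hx & Hy) r Hr.
    assert (HgapC : gap / (2 * C) * (2 * C) = gap) by (field; lra).
    apply Rle_lt_trans with (1 := Hg _ _ Hd r Hr). nra. }
  assert (Hnonneg : forall r, 0 <= r <= rad -> 0 <= g x y r).
  { intros r Hr. apply Rnot_lt_le. intros Hneg.
    apply (Hset (- g x y r / (2 * C))); [apply Rdiv_lt_0_compat; lra|].
    left. intros x' y' Hnear. exists r. split; [exact Hr|].
    apply Hclose with (r := r) in Hnear; [|lra | exact Hr].
    apply Rabs_def2 in Hnear. lra. }
  split; [exact Hnonneg|].
  destruct (continuity_ab_min (g x y) 0 rad) as [x0 [Hmin Hx0]];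
    [lra | intros; now apply cont_pt |].
  exists x0. split; [exact Hx0|].
  destruct (Hnonneg x0 Hx0) as [Hpos | <-]; [exfalso | reflexivity].
  apply (Hset (g x y x0 / (2 * C))); [apply Rdiv_lt_0_compat; lra|].
  right. intros x' y' Hnear (r & Hr & Hle).
  apply Hclose with (r := r) in Hnear; [|lra | exact Hr].
  apply Rabs_def2 in Hnear. specialize (Hmin r Hr). lra.
Qed.

(** The bound [|B| <= 2 * a * exp (K * rad)] makes the photon number [O(a^2)],
    uniformly in [lambda]. *)
Lemma vortex_profiles_small (M : nat) (rad bound N0 : R) :
  0 < rad -> 0 <= bound -> 0 < N0 ->
  exists a0, 0 < a0 <= 1 /\ forall lambda B phi, Rabs lambda <= bound ->
    regular_profile (2 * M + 1) (vortex_source M lambda) rad a0 B phi ->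
    photon_number rad (fun r => r ^ M * B r) < N0.
Proof.
  intros Hrad Hb HN0. pose proof PI_RGT_0 as Hpi.
  set (E := exp (growth rad (bound + 3) * rad)).
  assert (HE : 0 < E) by apply exp_pos.
  assert (HrM : 0 < rad ^ M) by (apply pow_lt, Hrad).
  set (C := 2 * PI * (rad * (rad * (rad ^ M * (2 * E)) ^ 2))).
  assert (HC : 0 < C).
  { unfold C. do 3 (apply Rmult_lt_0_compat; [lra|]).
    apply pow_lt, Rmult_lt_0_compat; lra. }
  (* The photon number is at most [C * a0 ^ 2 <= C * a0], as [a0 <= 1]. *)
  exists (Rmin 1 (N0 / (2 * C))). set (a0 := Rmin _ _).
  assert (Ha0 : 0 < a0).
  { apply Rmin_pos; [lra|]. apply Rdiv_lt_0_compat; lra. }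
  split; [split; [exact Ha0 | apply Rmin_l]|]. intros lambda B phi Hl Hreg.
  pose proof (vortex_source_lipschitz M lambda bound Hl) as HF.
  pose proof (regular_profile_bound _ _ rad _ a0 B phi HF Hrad ltac:(lra) Hreg) as HB.
  pose proof (regular_profile_cont _ _ _ _ _ _ Hreg) as HBc.
  apply Rle_lt_trans with (2 * PI * (rad * (rad * (rad ^ M * (2 * a0 * E)) ^ 2))).
  - apply photon_number_le; [exact Hrad | auto with cont |]. intros r Hr.
    rewrite Rabs_mult, Rabs_pos_eq by (apply pow_le; lra).
    apply Rmult_le_compat; [apply pow_le; lra | apply Rabs_pos | apply pow_incr; lra |].
    specialize (HB r Hr). now rewrite (Rabs_pos_eq a0) in HB by lra.
  - replace (2 * PI * (rad * (rad * (rad ^ M * (2 * a0 * E)) ^ 2))) with (C * a0 ^ 2)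
      by (unfold C; ring).
    assert (a0 <= 1) by apply Rmin_l. assert (a0 <= N0 / (2 * C)) by apply Rmin_r.
    assert (N0 / (2 * C) * C = N0 / 2) by (field; lra).
    assert (C * a0 <= N0 / 2) by nra.
    assert (0 < C * a0) by (apply Rmult_lt_0_compat; lra).
    replace (C * a0 ^ 2) with (C * a0 * a0) by ring. nra.
Qed.

(** Near the origin [B] stays above [a / 2], on an interval [0, 2 * x] whose length
    does not depend on [a] since the Lipschitz constant of the source does not;
    so the photon number is at least a constant times [a^2]. *)
Lemma vortex_profiles_large (M : nat) (rad bound N0 : R) :
  0 < rad -> 0 <= bound -> 0 < N0 ->
  exists a1, 1 <= a1 /\ forall lambda B phi, Rabs lambda <= bound ->
    regular_profile (2 * M + 1) (vortex_source M lambda) rad a1 B phi ->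
    N0 <= photon_number rad (fun r => r ^ M * B r).
Proof.
  intros Hrad Hb HN0. pose proof PI_RGT_0 as Hpi.
  set (L := bound + 3). set (E := exp (growth rad L * rad)).
  assert (HE : 0 < E) by apply exp_pos.
  assert (HL : 0 < L) by (unfold L; lra).
  assert (HrLE : 0 < 4 * rad * L * E) by (repeat apply Rmult_lt_0_compat; lra).
  (* For [r <= 2 * x] the deviation [|B r - a1|], which is at most
     [r * rad * L * (2 * a1 * E)], does not exceed [a1 / 2]. *)
  set (x := Rmin rad (/ (4 * rad * L * E)) / 2).
  assert (Hx : 0 < x).
  { apply Rdiv_lt_0_compat; [|lra]. apply Rmin_pos; [exact Hrad|].
    now apply Rinv_0_lt_compat. }
  assert (Hx1 : 2 * x <= rad).
  { unfold x. pose proof (Rmin_l rad (/ (4 * rad * L * E))). lra. }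
  assert (Hx2 : 2 * x * (4 * rad * L * E) <= 1).
  { assert (H2x : 2 * x <= / (4 * rad * L * E)).
    { unfold x. pose proof (Rmin_r rad (/ (4 * rad * L * E))). lra. }
    apply Rmult_le_compat_r with (r := 4 * rad * L * E) in H2x; [|lra].
    rewrite Rinv_l in H2x by lra. exact H2x. }
  assert (HxM : 0 < x ^ M) by (apply pow_lt, Hx).
  set (C := 2 * PI * (x * (x * (x ^ M / 2) ^ 2))).
  assert (HC : 0 < C).
  { unfold C. do 3 (apply Rmult_lt_0_compat; [lra|]). apply pow_lt. lra. }
  (* The photon number is at least [C * a1 ^ 2 >= C * a1], as [a1 >= 1]. *)
  exists (1 + N0 / C). set (a1 := 1 + N0 / C).
  assert (HaC : 0 < N0 / C) by now apply Rdiv_lt_0_compat.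
  assert (HaC' : a1 * C = C + N0) by (unfold a1; field; lra).
  assert (Ha1 : 1 <= a1) by (unfold a1; lra).
  split; [exact Ha1|]. intros lambda B phi Hl Hreg.
  pose proof (vortex_source_lipschitz M lambda bound Hl) as HF. fold L in HF.
  pose proof (regular_profile_bound _ _ rad L a1 B phi HF Hrad ltac:(lra) Hreg) as HB.
  fold E in HB. rewrite (Rabs_pos_eq a1) in HB by lra.
  pose proof (regular_profile_cont _ _ _ _ _ _ Hreg) as HBc.
  pose proof (fun r => regular_profile_source_le _ _ rad L a1 B phi r HF Hreg) as Hphi_le.
  apply Rle_trans with (2 * PI * (x * (x * (x ^ M * (a1 / 2)) ^ 2))).
  - replace (2 * PI * (x * (x * (x ^ M * (a1 / 2)) ^ 2))) with (C * a1 ^ 2)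
      by (unfold C; field).
    simpl. nra.
  - apply photon_number_ge; [exact Hx | exact Hx1 | | auto with cont |].
    { apply Rmult_le_pos; lra. }
    intros r Hr. apply Rmult_le_compat; [lra | lra | apply pow_incr; lra |].
    destruct Hreg as (Hphi & HBeq & _). rewrite HBeq.
    assert (Hpot : Rabs (potential (2 * M + 1) phi r) <= r * (rad * (L * (2 * a1 * E)))).
    { apply potential_abs_le; [exact Hphi | lra |]. intros t Ht.
      apply Rle_trans with (1 := Hphi_le t ltac:(lra)).
      apply Rmult_le_compat_l; [lra|]. apply HB. lra. }
    apply Rabs_le_between in Hpot.
    assert (r * (rad * (L * (2 * a1 * E))) <= a1 / 2).
    { replace (r * (rad * (L * (2 * a1 * E)))) with (r * (4 * rad * L * E) * (a1 / 2)) by field.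
      assert (r * (4 * rad * L * E) <= 1) by nra. nra. }
    lra.
Qed.

(** A change of [lambda] alters the source by [(l1 - l2) * B], and [B] is bounded
    uniformly over the parameters, so [regular_profile_stability] applies with one
    constant for all of them. *)
Lemma vortex_profiles_lipschitz (p M : nat) (rad bound a1 : R) :
  0 < rad -> 0 <= bound -> 0 < a1 ->
  exists C, 0 < C /\ forall l1 l2 b1 b2 B1 B2 phi1 phi2,
    Rabs l1 <= bound -> Rabs l2 <= bound -> 0 <= b1 <= a1 -> 0 <= b2 <= a1 ->
    regular_profile p (vortex_source M l1) rad b1 B1 phi1 ->
    regular_profile p (vortex_source M l2) rad b2 B2 phi2 ->
    forall r, 0 <= r <= rad ->
      Rabs (B1 r) <= C /\
      Rabs (B1 r - B2 r) <= C * (Rabs (b1 - b2) + Rabs (l1 - l2)).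
Proof.
  intros Hrad Hb Ha1. set (L := bound + 3). set (E := exp (growth rad L * rad)).
  assert (HE : 0 < E) by apply exp_pos.
  assert (HaE : 0 < a1 * E) by (apply Rmult_lt_0_compat; lra).
  assert (Hr2 : 0 < rad * rad) by (apply Rmult_lt_0_compat; lra).
  set (K := 2 * (a1 * E)). set (S := rad * rad * K).
  assert (HS : 0 < S) by (apply Rmult_lt_0_compat; unfold K; lra).
  exists (K + 2 * E * (1 + S)).
  assert (HSE : 0 < E * S) by (apply Rmult_lt_0_compat; lra).
  split; [unfold K; lra|].
  intros l1 l2 b1 b2 B1 B2 phi1 phi2 Hl1 Hl2 Hb1 Hb2 Hreg1 Hreg2.
  pose proof (vortex_source_lipschitz M l1 bound Hl1) as HF1. fold L in HF1.
  pose proof (vortex_source_lipschitz M l2 bound Hl2) as HF2. fold L in HF2.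
  assert (HL : 0 <= L) by (unfold L; lra).
  assert (HB1 : forall r, 0 <= r <= rad -> Rabs (B1 r) <= K).
  { intros r Hr.
    apply Rle_trans with (1 := regular_profile_bound _ _ rad L b1 B1 phi1 HF1 Hrad HL Hreg1 r Hr).
    rewrite Rabs_pos_eq by lra. fold E. unfold K. nra. }
  intros r Hr. split; [pose proof (HB1 r Hr); lra|].
  assert (Hstab : Rabs (B1 r - B2 r) <=
    2 * (Rabs (b1 - b2) + rad * (rad * (Rabs (l1 - l2) * K))) * E).
  { apply (regular_profile_stability p (vortex_source M l1) (vortex_source M l2) rad L
      (Rabs (l1 - l2) * K) b1 b2 B1 B2 phi1 phi2); auto.
    intros t Ht. unfold vortex_source.
    replace ((l1 - saturation (t ^ M * B1 t)) * B1 t - (l2 - saturation (t ^ M * B1 t)) * B1 t)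
      with ((l1 - l2) * B1 t) by ring.
    rewrite Rabs_mult. apply Rmult_le_compat_l; [apply Rabs_pos | auto]. }
  apply Rle_trans with (1 := Hstab).
  replace (rad * (rad * (Rabs (l1 - l2) * K))) with (S * Rabs (l1 - l2)) by (unfold S; ring).
  pose proof (Rabs_pos (b1 - b2)). pose proof (Rabs_pos (l1 - l2)).
  assert (0 <= K) by (unfold K; lra).
  assert (0 <= E * S * Rabs (b1 - b2)) by (apply Rmult_le_pos; lra).
  assert (0 <= E * Rabs (l1 - l2)) by (apply Rmult_le_pos; lra).
  assert (0 <= K * (Rabs (b1 - b2) + Rabs (l1 - l2))) by (apply Rmult_le_pos; lra).
  nra.
Qed.

Theorem theorem4p1 (m : Z) (rad N0 : R)
  (hm : (1 <= Z.abs m)%Z) (hrad : 0 < rad) (hN0 : 0 < N0) :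
  exists (A : R -> R) (lambda : R),
    solution_pair m rad A lambda /\
    (forall r : R, 0 < r < rad -> 0 < A r) /\
    photon_number rad A = N0.
Proof.
  set (M := Z.abs_nat m). set (p := (2 * M + 1)%nat).
  pose proof PI_RGT_0 as Hpi.
  assert (Hq : 0 < (rad / 4) ^ S p * (rad / 2)).
  { apply Rmult_lt_0_compat; [apply pow_lt; lra | lra]. }
  set (k := 1 + rad ^ p / ((rad / 4) ^ S p * (rad / 2))).
  assert (Hk1 : 0 <= rad ^ p / ((rad / 4) ^ S p * (rad / 2))).
  { apply Rdiv_le_0_compat; [apply pow_le; lra | exact Hq]. }
  assert (Hk : rad ^ p <= k * (rad / 4) ^ S p * (rad / 2)).
  { rewrite Rmult_assoc. unfold k. rewrite Rmult_plus_distr_r.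
    assert (rad ^ p / ((rad / 4) ^ S p * (rad / 2)) * ((rad / 4) ^ S p * (rad / 2)) = rad ^ p)
      by (field; split; [lra | apply pow_nonzero; lra]).
    lra. }
  assert (Hk0 : 1 <= k) by (unfold k; lra).
  assert (Hrange : forall l, - k <= l <= 1 / 4 -> Rabs l <= k) by (intros; apply Rabs_le; lra).
  destruct (vortex_profiles_small M rad k N0) as (a0 & Ha0 & Hsmall); [lra..|].
  destruct (vortex_profiles_large M rad k N0) as (a1 & Ha1 & Hlarge); [lra..|].
  destruct (vortex_profiles_lipschitz p M rad k a1) as (C & HC & Hlip); [lra..|].
  assert (Hex : forall a l, exists s : (R -> R) * (R -> R), Rabs l <= k ->
    regular_profile p (vortex_source M l) rad a (fst s) (snd s)).
  { intros a l. destruct (classic (Rabs l <= k)) as [Hl | Hl].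
    - destruct (regular_profile_exists p (vortex_source M l) rad (k + 3) a)
        as (B & phi & H); [now apply vortex_source_lipschitz | lra | lra |].
      exists (B, phi). intros _. exact H.
    - (* Outside the range of [l] the value is arbitrary. *)
      exists (fun _ => 0, fun _ => 0). tauto. }
  set (family := fun a l => proj1_sig (constructive_indefinite_description _ (Hex a l))).
  set (B := fun a l => fst (family a l)). set (phi := fun a l => snd (family a l)).
  assert (HB : forall a l, Rabs l <= k ->
    regular_profile p (vortex_source M l) rad a (B a l) (phi a l)).
  { intros a l. exact (proj2_sig (constructive_indefinite_description _ (Hex a l))). }
  clearbody B phi. clear Hex family.
  set (N := fun a l => photon_number rad (fun r => r ^ M * B a l r)).
  set (dom := rectangle a0 a1 (- k) (1 / 4)).
  destruct (frontiers_cross a0 a1 (- k) (1 / 4) (fun a l => N a l < N0)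
    (fun a l => exists r, 0 <= r <= rad /\ B a l r <= 0)) as (a & l & [Ha Hl] & Hfront).
  - lra.
  - lra.
  - intros l Hl. apply (Hsmall l (B a0 l) (phi a0 l)); [now apply Hrange|].
    apply HB. now apply Hrange.
  - intros l Hl. apply Rle_not_lt.
    apply (Hlarge l (B a1 l) (phi a1 l)); [now apply Hrange|].
    apply HB. now apply Hrange.
  - intros a Ha. apply (vortex_profile_vanishes p M rad k a (B a (- k)) (phi a (- k))); try lra.
    apply HB, Hrange. lra.
  - intros a Ha (r & Hr & Hle).
    pose proof (vortex_profile_positive p M rad (1 / 4) a (B a (1 / 4)) (phi a (1 / 4))
      (HB a (1 / 4) (Hrange (1 / 4) ltac:(lra))) ltac:(lra) ltac:(lra) r Hr). lra.
  - fold dom in Hfront.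
    pose proof (HB a l (Hrange l Hl)) as Hreg.
    pose proof (fun x y (H : Rabs y <= k) => regular_profile_cont _ _ _ _ _ _ (HB x y H)) as HBc.
    assert (Hclose : forall x y, dom x y -> forall r, 0 <= r <= rad ->
      Rabs (B x y r) <= C /\
      Rabs (B x y r - B a l r) <= C * (Rabs (x - a) + Rabs (y - l))).
    { intros x y [Hx Hy]. apply (Hlip y l x a (B x y) (B a l) (phi x y) (phi a l)); auto; lra. }
    assert (HrM : 0 < rad ^ M) by (apply pow_lt, hrad).
    destruct (unsettled_touching dom B rad C a l) as [Hnonneg (r0 & Hr0 & Hzero)];
      [exact HC | exact hrad | auto | intros; now apply Hclose | apply Hfront |].
    assert (Hnoint : forall r, 0 < r < rad -> B a l r <> 0).
    { intros r Hr Hr_zero.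
      pose proof (regular_profile_no_interior_zero p _ rad (k + 3) a _ _ r
        (vortex_source_lipschitz M l k (Hrange l Hl)) ltac:(lra) Hreg Hnonneg Hr Hr_zero).
      lra. }
    assert (HBrad : B a l rad = 0).
    { pose proof (regular_profile_0 _ _ _ _ _ _ Hreg) as HB0.
      replace rad with r0; [exact Hzero|]. apply NNPP. intros Hne.
      apply (Hnoint r0); [|exact Hzero]. split; [|lra].
      destruct (Rle_lt_or_eq_dec 0 r0 (proj1 Hr0)) as [H | <-]; lra. }
    exists (fun r => r ^ M * B a l r), l. split; [|split].
    + now apply (vortex_solution_of_profile m rad l a (B a l) (phi a l)).
    + intros r Hr. apply Rmult_lt_0_compat; [apply pow_lt; lra|].
      pose proof (Hnonneg r ltac:(lra)). pose proof (Hnoint r Hr). lra.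
    + apply (unsettled_level dom N (4 * PI * rad ^ 2 * (rad ^ M * C) * (rad ^ M * C)) N0 a l).
      * assert (0 < rad ^ M * C) by (apply Rmult_lt_0_compat; lra).
        assert (0 < rad ^ 2) by (apply pow_lt, hrad).
        do 3 (apply Rmult_lt_0_compat; [|lra]). lra.
      * intros x y Hxy. rewrite Rmult_assoc with (r2 := rad ^ M * C) (r3 := _ + _).
        assert (Hmul : forall r u c, 0 <= r <= rad -> Rabs u <= c ->
          Rabs (r ^ M * u) <= rad ^ M * c).
        { intros r u c Hr Hu. rewrite Rabs_mult, Rabs_pos_eq by (apply pow_le; lra).
          apply Rmult_le_compat; [apply pow_le; lra | apply Rabs_pos | | exact Hu].
          apply pow_incr; lra. }
        unfold N. apply photon_number_lipschitz; [exact hrad | | | | |].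
        -- apply cont_mult; [apply cont_pow | apply HBc, Hrange, Hxy].
        -- apply cont_mult; [apply cont_pow | now apply HBc, Hrange].
        -- intros r Hr. apply Hmul; [exact Hr | now apply Hclose].
        -- intros r Hr. apply Hmul; [exact Hr |]. apply Hclose; [now split | exact Hr].
        -- intros r Hr. rewrite <- Rmult_minus_distr_l, Rmult_assoc.
           apply Hmul; [exact Hr | now apply Hclose].
      * apply Hfront.
Qed.
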